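(* Suppose that $\sum_{n=0}^\infty a_n^{-1}<\infty$, that $a_n\to\infty$, $\beta_n\to\beta_\infty$ as $n\to\infty$ with $|\beta_\infty|<1$, and that $(k_n-1)\in\ell^1$ and $(\beta_n')\in\ell^1(\mathbb Z_+)$. Let $\omega\in\mathbb C$, $|\omega|=1$. If $z\in\mathbb C$ is not an eigenvalue of the self-adjoint operator $J_\omega$, then its resolvent $R_\omega(z)=(J_\omega-zI)^{-1}$ is in the Hilbert–Schmidt class. Thus, the spectrum of the operator $J_\omega$ is discrete and consists of the points $z$ where $$\sigma_+(z)-\omega\,\sigma_-(z)=0.$$
   Context: $\mathbb Z_+=\{0,1,2,\dots\}$; $a_n>0$ and $b_n\in\mathbb R$ for $n\in\mathbb Z_+$, and $a_{-1}>0$ is an arbitrary fixed number. For a sequence $x_n$ put $x_n'=x_{n+1}-x_n$; $\beta_n=-\frac{b_n}{2\sqrt{a_{n-1}a_n}}$, $k_n=\frac{a_n}{\sqrt{a_{n-1}a_{n+1}}}$. The Jacobi matrix acts by $(\mathcal Ju)_0=b_0u_0+a_0u_1$, $(\mathcal Ju)_n=a_{n-1}u_{n-1}+b_nu_n+a_nu_{n+1}$, $n\ge1$. $J_{\min}$ is the restriction of $\mathcal J$ to finitely supported sequences in $\ell^2(\mathbb Z_+)$; $J_{\max}$ is the restriction of $\mathcal J$ to $\mathcal D(J_{\max})=\{u\in\ell^2(\mathbb Z_+):\mathcal Ju\in\ell^2(\mathbb Z_+)\}$. The polynomials $P_n(z)$ satisfy $a_{n-1}P_{n-1}+b_nP_n+a_nP_{n+1}=zP_n$,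 $n\ge0$, with $P_{-1}=0$, $P_0=1$. Fix $N_0$ such that $|\beta_n|$ is separated from $1$ and $|\beta_n|<1$ for $n\ge N_0$; put $\Theta_n^{(\pm)}=\exp\big(\mp i\sum_{m=N_0}^{n-1}\arccos\beta_m\big)$. If $\sum_{n=0}^\infty a_n^{-1}<\infty$, $a_n\to\infty$, $\beta_n\to\beta_\infty$ as $n\to\infty$ with $|\beta_\infty|<1$, $(k_n-1)\in\ell^1$ and $(\beta_n')\in\ell^1(\mathbb Z_+)$, then for every $z\in\mathbb C$ the recurrence $a_{n-1}f_{n-1}+b_nf_n+a_nf_{n+1}=zf_n$, $n\ge0$, has unique, linearly independent solutions $f_n^{(\pm)}(z)$ with $f_n^{(\pm)}(z)=a_n^{-1/2}\Theta_n^{(\pm)}(1+o(1))$ as $n\to\infty$; the coefficients $\sigma_\pm(z)$ are defined by $P_n(z)=\sigma_+(z)f_n^{(+)}(z)+\sigma_-(z)f_n^{(-)}(z)$. If $\sum_{n=0}^\infty a_n^{-1}<\infty$, $a_n\to\infty$, $\beta_n\to\beta_\infty$ as $n\to\infty$ with $|\beta_\infty|<1$, $(k_n-1)\in\ell^1$ and $(\beta_n')\in\ell^1(\mathbb Z_+)$, then every $u=(u_n)\in\mathcal D(J_{\max})$ has asymptotics $u_n=a_n^{-1/2}\big(s_+\Theta_n^{(+)}+s_-\Theta_n^{(-)}+o(1)\big)$ as $n\to\infty$ with uniquely determined numbers $s_\pm=s_\pm(u)$. $J_\omega$ is the restriction of $J_{\max}$ to $\mathcal D(J_\omega)=\{u\in\mathcal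 D(J_{\max}):s_+(u)=\omega s_-(u)\}$; it is a self-adjoint operator. *)

(* Defs.v *)
From Stdlib Require Import Reals ClassicalEpsilon.
From Coquelicot Require Import Coquelicot.

Open Scope R_scope.

(** * The Hilbert space l^2(Z_+) *)

Definition l2 (u : nat -> C) : Prop := ex_series (fun n => Cmod (u n) ^ 2).

Definition l2_norm (u : nat -> C) : R := sqrt (Series (fun n => Cmod (u n) ^ 2)).

(* Linear in the first argument; the series converge absolutely on l^2. *)
Definition inner (u v : nat -> C) : C :=
  (Series (fun n => Re (u n * Cconj (v n))%C),
   Series (fun n => Im (u n * Cconj (v n))%C)).

Definition orthonormal_basis (e : nat -> nat -> C) : Prop :=
  (forall k, l2 (e k)) /\
  (forall j k, inner (e j) (e k) = if Nat.eqb j k then RtoC 1 else RtoC 0) /\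
  (forall u, l2 u -> (forall k, inner u (e k) = RtoC 0) ->
     forall n, u n = RtoC 0).

(** * Operators in l^2(Z_+) *)

(* [act] is meaningful on [dom] only. *)
Record operator := Op {
  dom : (nat -> C) -> Prop;
  act : (nat -> C) -> nat -> C
}.

(* Only the values of [T] on l^2 matter. *)
Definition bounded_operator (T : (nat -> C) -> nat -> C) : Prop :=
  (forall u, l2 u -> l2 (T u)) /\
  (forall u v, l2 u -> l2 v ->
     forall n, T (fun m => u m + v m)%C n = (T u n + T v n)%C) /\
  (forall (c : C) u, l2 u ->
     forall n, T (fun m => c * u m)%C n = (c * T u n)%C) /\
  (exists K : R, forall u, l2 u -> l2_norm (T u) <= K * l2_norm u).

Definition hilbert_schmidt (T : (nat -> C) -> nat -> C) : Prop :=
  bounded_operator T /\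
  forall e, orthonormal_basis e -> ex_series (fun k => l2_norm (T (e k)) ^ 2).

Definition shifted (A : operator) (z : C) (u : nat -> C) (n : nat) : C :=
  (act A u n - z * u n)%C.

(* [T] is the inverse of [A - z : dom A -> l^2]. *)
Definition is_resolvent (A : operator) (z : C) (T : (nat -> C) -> nat -> C) : Prop :=
  (forall g, l2 g -> dom A (T g) /\ forall n, shifted A z (T g) n = g n) /\
  (forall u, dom A u -> forall n, T (shifted A z u) n = u n).

Definition spectrum (A : operator) (z : C) : Prop :=
  ~ exists T, is_resolvent A z T /\ bounded_operator T.

Definition eigenspace (A : operator) (z : C) (u : nat -> C) : Prop :=
  dom A u /\ forall n, act A u n = (z * u n)%C.

Definition eigenvalue (A : operator) (z : C) : Prop :=
  exists u, eigenspace A z u /\ exists n, u n <> RtoC 0.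

Definition finite_multiplicity (A : operator) (z : C) : Prop :=
  exists (d : nat) (v : nat -> nat -> C), forall u, eigenspace A z u ->
    exists c : nat -> C, forall n, u n = sum_n (fun k => c k * v k n)%C d.

Definition isolated_in (S : C -> Prop) (z : C) : Prop :=
  exists eps : R, 0 < eps /\ forall w, S w -> w <> z -> eps <= Cmod (w - z)%C.

Definition discrete_spectrum (A : operator) : Prop :=
  forall z, spectrum A z ->
    isolated_in (spectrum A) z /\ eigenvalue A z /\ finite_multiplicity A z.

(** * Jacobi coefficients: [am] stands for a_{-1} *)

(* [prev x_ x n] is x_{n-1}, with x_{-1} = x_. *)
Definition prev {T : Type} (x_ : T) (x : nat -> T) (n : nat) : T :=
  match n with O => x_ | S m => x m end.

Definition beta (am : R) (a b : nat -> R) (n : nat) : R :=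
  - b n / (2 * sqrt (prev am a n * a n)).

Definition kappa (am : R) (a : nat -> R) (n : nat) : R :=
  a n / sqrt (prev am a n * a (S n)).

Definition jacobi (a b : nat -> R) (u : nat -> C) (n : nat) : C :=
  match n with
  | O => (b O * u O + a O * u 1%nat)%C
  | S m => (a m * u m + b n * u n + a n * u (S n))%C
  end.

Definition dom_Jmax (a b : nat -> R) (u : nat -> C) : Prop :=
  l2 u /\ l2 (jacobi a b u).

(** * Solutions of the recurrence *)

Definition is_solution (am : R) (a b : nat -> R) (z : C) (f : nat -> C) : Prop :=
  exists f_ : C, forall n,
    (prev am a n * prev f_ f n + b n * f n + a n * f (S n) = z * f n)%C.

(* The pair (P_{n-1}(z), P_n(z)). *)
Fixpoint P_pair (am : R) (a b : nat -> R) (z : C) (n : nat) : C * C :=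
  match n with
  | O => (RtoC 0, RtoC 1)
  | S m => let (p, q) := P_pair am a b z m in
           (q, ((z - b m) * q - prev am a m * p) / a m)%C
  end.

Definition P (am : R) (a b : nat -> R) (z : C) (n : nat) : C :=
  snd (P_pair am a b z n).

(* The sum of arccos beta_m over N0 <= m < n. *)
Fixpoint phase (am : R) (a b : nat -> R) (N0 n : nat) : R :=
  match n with
  | O => 0
  | S m => phase am a b N0 m +
           (if Nat.leb N0 m then acos (beta am a b m) else 0)
  end.

Definition cis (t : R) : C := (cos t, sin t).

Definition Theta_plus am a b N0 n : C := cis (- phase am a b N0 n).
Definition Theta_minus am a b N0 n : C := cis (phase am a b N0 n).

Definition o1 (r : nat -> C) : Prop := is_lim_seq (fun n => Cmod (r n)) 0.

(* The following objects exist and are unique under the assumptions on the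
   coefficients under which they are used; [epsilon] then selects them. *)

Definition jost (am : R) (a b : nat -> R) (Theta : nat -> C) (z : C) : nat -> C :=
  epsilon (inhabits (fun _ => RtoC 0)) (fun f =>
    is_solution am a b z f /\
    exists r, o1 r /\
      forall n, f n = (RtoC (/ sqrt (a n)) * Theta n * (1 + r n))%C).

Definition f_plus am a b N0 (z : C) := jost am a b (Theta_plus am a b N0) z.
Definition f_minus am a b N0 (z : C) := jost am a b (Theta_minus am a b N0) z.

(* The pair (sigma_+(z), sigma_-(z)). *)
Definition sigma (am : R) (a b : nat -> R) (N0 : nat) (z : C) : C * C :=
  epsilon (inhabits (RtoC 0, RtoC 0)) (fun s => forall n,
    P am a b z n =
      (fst s * f_plus am a b N0 z n + snd s * f_minus am a b N0 z n)%C).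

Definition sigma_plus am a b N0 z : C := fst (sigma am a b N0 z).
Definition sigma_minus am a b N0 z : C := snd (sigma am a b N0 z).

(* The pair (s_+(u), s_-(u)). *)
Definition s_coef (am : R) (a b : nat -> R) (N0 : nat) (u : nat -> C) : C * C :=
  epsilon (inhabits (RtoC 0, RtoC 0)) (fun s =>
    exists r, o1 r /\ forall n,
      u n = (RtoC (/ sqrt (a n)) *
             (fst s * Theta_plus am a b N0 n +
              snd s * Theta_minus am a b N0 n + r n))%C).

Definition s_plus am a b N0 u : C := fst (s_coef am a b N0 u).
Definition s_minus am a b N0 u : C := snd (s_coef am a b N0 u).

Definition J_omega (am : R) (a b : nat -> R) (N0 : nat) (omega : C) : operator :=
  Op (fun u => dom_Jmax a b u /\
               s_plus am a b N0 u = (omega * s_minus am a b N0 u)%C)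
     (jacobi a b).

(* Main.v *)
(* Writing u_n = a_n^(-1/2) v_n turns the recurrence J u = h into
   v_(n-1) - 2 beta_n v_n + k_n v_(n+1) = a_(n-1)^(-1/2) h_n, an absolutely
   summable perturbation of an oscillation with slowly varying phase
   arccos beta_n. Variation of constants and Gronwall's inequality give the
   asymptotics of all solutions and of all elements of D(J_max), and the
   Wronskian shows that a solution is determined by its pair (s_+, s_-).

   If sigma_+(z) <> omega sigma_-(z), then P(z) and the solution with
   (s_+, s_-) = (omega, 1) are independent, and the Green kernel built from them
   is O((a_n a_m)^(-1/2)), hence Hilbert-Schmidt because sum 1/a_n < oo.
   Otherwise P(z) is an eigenvector.

   Isolation of the eigenvalues does not need analyticity in z: an eigenvalue z
   of J_omega is not one of J_(-omega). With T the resolvent of J_(-omega) at z,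
   P(w) - (w - z) T P(w) solves the recurrence at z, so it is a multiple of P(z),
   which is orthogonal to P(w) if w is another eigenvalue; hence
   1 <= |w - z| |T|. *)
Require Import Defs.
From Stdlib Require Import Reals Arith Lra Lia FunctionalExtensionality ClassicalEpsilon.
From Coquelicot Require Import Coquelicot.

Open Scope R_scope.

(** * Series of nonnegative terms *)

(** The numbers [s_plus], [s_minus], the solutions [f_plus], [f_minus] and the pair [sigma] are
    chosen by [epsilon], so nothing is known about them until objects of the required kind are shown
    to exist, and to be unique where a value is to be computed. The arguments therefore run through
    the relation [has_asymptotics] between a sequence and its pair. The boundary condition becomes
    one linear equation for this pair, and [sigma] is identified as the pair of [P].

    The hypotheses share the work in the asymptotics: summability of 1/a_n turns square-summable
    right-hand sides into summable errors, the variation of beta_n bounds the drift of the phase,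
    and k_n - 1 bounds the mismatch of amplitudes between neighbouring indices.

    The resolvent is written down for every complex omega away from the zeros, which settles what
    the spectrum is. The condition |omega| = 1 enters through the symmetry of the operator and the
    orthogonality of its eigenvectors. The choice of -omega for the auxiliary resolvent rests on the
    fact that s_+ = omega s_- and s_+ = -omega s_- together force the pair to vanish, which is
    impossible for P. *)

Lemma ex_series_dominated (u v : nat -> R) :
  (forall n, 0 <= u n <= v n) -> ex_series v -> ex_series u.
Proof.
  intros H Hv. apply (@ex_series_le R_AbsRing R_CompleteNormedModule) with v; auto.
  intros n. unfold norm; simpl; unfold abs; simpl.
  rewrite Rabs_pos_eq; apply H.
Qed.

Lemma ex_series_add (u v : nat -> R) :
  ex_series u -> ex_series v -> ex_series (fun n => u n + v n).
Proof. exact (@ex_series_plus R_AbsRing R_NormedModule u v). Qed.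

Lemma ex_series_cmult (c : R) (u : nat -> R) :
  ex_series u -> ex_series (fun n => c * u n).
Proof. exact (@ex_series_scal R_AbsRing R_NormedModule c u). Qed.

Lemma ex_series_shift (u : nat -> R) (k : nat) :
  ex_series u -> ex_series (fun n => u (k + n)%nat).
Proof. apply ex_series_incr_n. Qed.

Lemma sum_n_le_Series (u : nat -> R) (N : nat) :
  (forall n, 0 <= u n) -> ex_series u -> sum_n u N <= Series u.
Proof.
  intros Hp Hu.
  assert (H : is_lim_seq (sum_n u) (Series u)) by (apply Series_correct, Hu).
  apply (is_lim_seq_incr_compare (sum_n u) _ H).
  intros n. rewrite sum_Sn. unfold plus; simpl. specialize (Hp (S n)). lra.
Qed.

Lemma ex_series_of_bounded (u : nat -> R) (K : R) :
  (forall n, 0 <= u n) -> (forall N, sum_n u N <= K) -> ex_series u.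
Proof.
  intros Hp H.
  destruct (ex_finite_lim_seq_incr (sum_n u) K) as [l Hl].
  - intros n. rewrite sum_Sn. unfold plus; simpl. specialize (Hp (S n)). lra.
  - exact H.
  - exists l. exact Hl.
Qed.

Lemma Series_nonneg (u : nat -> R) :
  (forall n, 0 <= u n) -> ex_series u -> 0 <= Series u.
Proof.
  intros Hp Hu. apply Rle_trans with (sum_n u 0).
  - rewrite sum_O. apply Hp.
  - apply sum_n_le_Series; auto.
Qed.

Lemma term_le_Series (u : nat -> R) (n : nat) :
  (forall m, 0 <= u m) -> ex_series u -> u n <= Series u.
Proof.
  intros Hp Hu. apply Rle_trans with (sum_n u n).
  - destruct n; [rewrite sum_O; lra|]. rewrite sum_Sn. unfold plus; simpl.
    enough (0 <= sum_n u n) by lra. clear Hu.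
    induction n; [rewrite sum_O; auto|].
    rewrite sum_Sn. unfold plus; simpl. specialize (Hp (S n)). lra.
  - apply sum_n_le_Series; auto.
Qed.

Lemma Series_tail_lim (u : nat -> R) :
  ex_series u -> is_lim_seq (fun n => Series (fun k => u (S n + k)%nat)) 0.
Proof.
  intros Hu.
  assert (Hl : is_lim_seq (sum_n u) (Series u)) by (apply Series_correct, Hu).
  apply is_lim_seq_ext with (fun n => Series u - sum_n u n).
  - intros n. rewrite (Series_incr_n u (S n)) by (auto with arith).
    rewrite sum_n_Reals. simpl pred. ring.
  - replace (Finite 0) with (Finite (Series u - Series u)) by (f_equal; ring).
    apply is_lim_seq_minus'; [apply is_lim_seq_const|exact Hl].
Qed.

(** Iteration multiplies by the product of the factors [1 + eps k], which is at most the exponential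
    of the sum of [eps]. Hence the initial value and every [gam k] are amplified by at most the same
    fixed factor. *)
Lemma gronwall (y eps gam : nat -> R) :
  (forall n, 0 <= y n) -> (forall n, 0 <= eps n) -> (forall n, 0 <= gam n) ->
  ex_series eps -> ex_series gam ->
  (forall n, y (S n) <= (1 + eps n) * y n + gam n) ->
  exists K, 0 <= K /\ forall n, y n <= K.
Proof.
  intros Hy He Hg Se Sg H.
  set (E := Series eps). set (G := Series gam).
  assert (HG : 0 <= G) by (apply Series_nonneg; auto).
  assert (A : forall n, y (S n) <= exp (sum_n eps n) * (y O + sum_n gam n)).
  { induction n.
    - rewrite !sum_O. specialize (H O). pose proof (Hy O). pose proof (He O).
      pose proof (Hg O). pose proof (exp_ineq1_le (eps O)). nra.
    - rewrite !sum_Sn. unfold plus; simpl. rewrite exp_plus.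
      specialize (H (S n)). pose proof (He (S n)). pose proof (Hg (S n)).
      pose proof (exp_ineq1_le (eps (S n))).
      assert (1 <= exp (sum_n eps n)).
      { pose proof (exp_ineq1_le (sum_n eps n)).
        enough (0 <= sum_n eps n) by lra.
        clear - He. induction n; [rewrite sum_O; auto|].
        rewrite sum_Sn. unfold plus; simpl. specialize (He (S n)). lra. }
      assert (0 <= y O + sum_n gam n) by
        (pose proof (Hy (S n)); pose proof (exp_pos (sum_n eps n)); nra).
      set (B := exp (sum_n eps n)) in *. set (e := exp (eps (S n))) in *.
      set (Y := y O + sum_n gam n) in *.
      replace (y O + (sum_n gam n + gam (S n))) with (Y + gam (S n))
        by (unfold Y; ring).
      assert ((1 + eps (S n)) * y (S n) <= e * (B * Y)).
      { apply Rmult_le_compat; auto; lra. }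
      assert (1 * gam (S n) <= B * e * gam (S n)).
      { apply Rmult_le_compat_r; auto.
        replace 1 with (1 * 1) by ring. apply Rmult_le_compat; lra. }
      nra. }
  exists (exp E * (y O + G)). split.
  { pose proof (exp_pos E). specialize (Hy O). nra. }
  assert (E1 : 1 <= exp E).
  { pose proof (exp_ineq1_le E). pose proof (Series_nonneg eps He Se).
    unfold E in *. lra. }
  intros [|n].
  - specialize (Hy O). nra.
  - apply Rle_trans with (1 := A n). apply Rmult_le_compat.
    + apply Rlt_le, exp_pos.
    + pose proof (Hy (S n)); pose proof (exp_pos (sum_n eps n)). specialize (A n). nra.
    + destruct (sum_n_le_Series eps n He Se) as [h|h].
      * apply Rlt_le, exp_increasing, h.
      * rewrite h. apply Rle_refl.
    + apply Rplus_le_compat_l. apply sum_n_le_Series; auto.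
Qed.

(** * Complex sequences *)

Lemma Copp_mult_l (x y : C) : (- (x * y) = (- x) * y)%C.
Proof. ring. Qed.

Lemma Cconj_RtoC (x : R) : Cconj (RtoC x) = RtoC x.
Proof. unfold Cconj, RtoC; simpl. now rewrite Ropp_0. Qed.

Lemma Cmult_eq_0_l (x y : C) : (x * y)%C = RtoC 0 -> x <> RtoC 0 -> y = RtoC 0.
Proof.
  intros H Hx. replace y with (/ x * (x * y))%C by (field; exact Hx).
  rewrite H. ring.
Qed.

Lemma Cmod_minus_sym (x y : C) : Cmod (x - y) = Cmod (y - x).
Proof. rewrite <- Cmod_opp. f_equal. ring. Qed.

Lemma Cmod_triangle_minus (x y : C) : Cmod (x - y) <= Cmod x + Cmod y.
Proof.
  unfold Cminus. rewrite <- (Cmod_opp y). apply Cmod_triangle.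
Qed.

Lemma Im_le_Cmod (x : C) : Rabs (Im x) <= Cmod x.
Proof. eapply Rle_trans; [apply Rmax_r | apply (Rmax_Cmod x)]. Qed.

Lemma Cmod_le_ReIm (x : C) : Cmod x <= Rabs (Re x) + Rabs (Im x).
Proof.
  replace x with (RtoC (Re x) + Ci * RtoC (Im x))%C at 1.
  - eapply Rle_trans; [apply Cmod_triangle|].
    rewrite Cmod_mult, Cmod_Ci, !Cmod_R. lra.
  - destruct x; unfold Re, Im, RtoC, Ci, Cplus, Cmult; simpl. f_equal; ring.
Qed.

Lemma o1_dominated (r : nat -> C) (e : nat -> R) :
  (forall n, Cmod (r n) <= e n) -> is_lim_seq e 0 -> o1 r.
Proof.
  intros H He. unfold o1.
  apply is_lim_seq_le_le with (fun _ => 0) e; auto.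
  - intros n; split; [apply Cmod_ge_0|apply H].
  - apply is_lim_seq_const.
Qed.

Lemma o1_of_sqr (r : nat -> C) (e : nat -> R) :
  (forall n, Cmod (r n) ^ 2 <= e n) -> is_lim_seq e 0 -> o1 r.
Proof.
  intros H He. apply o1_dominated with (fun n => sqrt (e n)).
  - intros n. rewrite <- (sqrt_pow2 (Cmod (r n))) by apply Cmod_ge_0.
    apply sqrt_le_1_alt, H.
  - rewrite <- sqrt_0. apply (is_lim_seq_continuous sqrt e 0); auto.
    apply continuity_pt_filterlim, continuous_sqrt.
Qed.

Lemma o1_plus (r s : nat -> C) : o1 r -> o1 s -> o1 (fun n => r n + s n)%C.
Proof.
  intros Hr Hs. apply o1_dominated with (fun n => Cmod (r n) + Cmod (s n)).
  - intros n; apply Cmod_triangle.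
  - replace (Finite 0) with (Finite (0 + 0)) by (f_equal; ring).
    apply is_lim_seq_plus'; auto.
Qed.

Lemma o1_mult_bounded (r s : nat -> C) (K : R) :
  (forall n, Cmod (s n) <= K) -> o1 r -> o1 (fun n => s n * r n)%C.
Proof.
  intros Hs Hr. apply o1_dominated with (fun n => K * Cmod (r n)).
  - intros n. rewrite Cmod_mult. apply Rmult_le_compat_r; auto. apply Cmod_ge_0.
  - replace (Finite 0) with (Finite (K * 0)) by (f_equal; ring).
    apply (is_lim_seq_scal_l _ K (Finite 0)). exact Hr.
Qed.

Lemma o1_ext (r s : nat -> C) : (forall n, r n = s n) -> o1 r -> o1 s.
Proof.
  intros H. apply is_lim_seq_ext. intros n. now rewrite H.
Qed.

Lemma o1_opp (r : nat -> C) : o1 r -> o1 (fun n => - r n)%C.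
Proof. apply is_lim_seq_ext. intros n. now rewrite Cmod_opp. Qed.

Lemma o1_incr (r : nat -> C) : o1 r -> o1 (fun n => r (S n)).
Proof. apply is_lim_seq_incr_1. Qed.

Lemma o1_const (c : C) : o1 (fun _ => c) -> c = RtoC 0.
Proof.
  intros H. apply Cmod_eq_0.
  pose proof (is_lim_seq_unique _ _ H) as H1. cbv beta in H1. rewrite Lim_seq_const in H1.
  now injection H1.
Qed.

Lemma o1_bounded (r : nat -> C) : o1 r -> exists K, forall n, Cmod (r n) <= K.
Proof.
  intros H.
  apply is_lim_seq_spec in H. destruct (H (mkposreal 1 Rlt_0_1)) as [N HN].
  simpl in HN.
  assert (B : forall M, exists K, forall n, (n < M)%nat -> Cmod (r n) <= K).
  { induction M as [|M [K HK]].
    - exists 0. lia.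
    - exists (Rmax K (Cmod (r M))). intros n Hn.
      destruct (Nat.eq_dec n M) as [->|]; [apply Rmax_r|].
      eapply Rle_trans; [apply HK; lia | apply Rmax_l]. }
  destruct (B N) as [K HK]. exists (Rmax K 1). intros n.
  destruct (le_lt_dec N n) as [h|h].
  - eapply Rle_trans; [|apply Rmax_r]. specialize (HN n h).
    apply Rabs_def2 in HN. lra.
  - eapply Rle_trans; [apply HK; lia | apply Rmax_l].
Qed.

Lemma telescoping_lim (x : nat -> R) :
  ex_series (fun n => x (S n) - x n) -> exists l, is_lim_seq x (Finite l).
Proof.
  intros [l Hl]. exists (x O + l).
  apply is_lim_seq_incr_1.
  apply is_lim_seq_ext with (fun n => x O + sum_n (fun n => x (S n) - x n) n).
  - induction n; [rewrite sum_O; ring|].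
    rewrite sum_Sn. unfold plus; simpl. rewrite <- Rplus_assoc, IHn. ring.
  - apply is_lim_seq_plus'; [apply is_lim_seq_const|exact Hl].
Qed.

Lemma bounded_variation_lim (c : nat -> C) :
  ex_series (fun n => Cmod (c (S n) - c n)) -> exists l, o1 (fun n => c n - l)%C.
Proof.
  intros H.
  assert (H1 : ex_series (fun n => Re (c (S n)) - Re (c n))).
  { apply ex_series_Rabs. apply ex_series_dominated with (2 := H).
    intros n; split; [apply Rabs_pos|]. apply (re_le_Cmod (c (S n) - c n)). }
  assert (H2 : ex_series (fun n => Im (c (S n)) - Im (c n))).
  { apply ex_series_Rabs. apply ex_series_dominated with (2 := H).
    intros n; split; [apply Rabs_pos|]. apply (Im_le_Cmod (c (S n) - c n)). }
  destruct (telescoping_lim _ H1) as [l1 L1].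
  destruct (telescoping_lim _ H2) as [l2 L2].
  exists (l1, l2).
  apply o1_dominated with (fun n => Rabs (Re (c n) - l1) + Rabs (Im (c n) - l2)).
  { intros n. apply (Cmod_le_ReIm (c n - (l1, l2))). }
  replace (Finite 0) with (Finite (0 + 0)) by (f_equal; ring).
  apply is_lim_seq_plus'; apply -> is_lim_seq_abs_0.
  - replace (Finite 0) with (Finite (l1 - l1)) by (f_equal; ring).
    apply is_lim_seq_minus'; [exact L1|apply is_lim_seq_const].
  - replace (Finite 0) with (Finite (l2 - l2)) by (f_equal; ring).
    apply is_lim_seq_minus'; [exact L2|apply is_lim_seq_const].
Qed.

(** * Perturbation of an oscillatory three-term recurrence *)

Lemma cis_plus (s t : R) : cis (s + t) = (cis s * cis t)%C.
Proof.
  unfold cis, Cmult; simpl. rewrite cos_plus, sin_plus. f_equal; ring.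
Qed.

Lemma cis_opp_mult (t : R) : (cis (- t) * cis t)%C = RtoC 1.
Proof.
  rewrite <- cis_plus, Rplus_opp_l. unfold cis. rewrite cos_0, sin_0. reflexivity.
Qed.

Lemma Cmod_cis (t : R) : Cmod (cis t) = 1.
Proof.
  unfold Cmod, cis; simpl. pose proof (sin2_cos2 t) as H. unfold Rsqr in H.
  replace (_ + _) with 1 by lra. apply sqrt_1.
Qed.

Lemma Cconj_cis (t : R) : Cconj (cis t) = cis (- t).
Proof. unfold cis, Cconj; simpl. now rewrite cos_neg, sin_neg. Qed.

Lemma cis_sum (t : R) : (cis t + cis (- t))%C = RtoC (2 * cos t).
Proof.
  unfold cis, Cplus, RtoC; simpl. rewrite cos_neg, sin_neg. f_equal; ring.
Qed.

Lemma Cmod_cis_minus_conj (t : R) : Cmod (cis t - cis (- t)) = 2 * Rabs (sin t).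
Proof.
  replace (cis t - cis (- t))%C with (Ci * RtoC (2 * sin t))%C.
  - rewrite Cmod_mult, Cmod_Ci, Cmod_R, Rabs_mult, (Rabs_pos_eq 2); lra.
  - unfold cis, Cminus, Copp, Cplus, Cmult, RtoC, Ci; simpl.
    rewrite cos_neg, sin_neg. f_equal; ring.
Qed.

(** The differences of sin^2 and of cos^2 are opposite. Factoring both, with [sin s + sin t] at
    least [2 * d] and the sum of the cosines at most 2 in modulus, gives the factor [/ d]. In this
    way the variation of the cosines controls that of the phase factors without differentiating
    arccos. *)
Lemma Cmod_cis_minus_le (d s t : R) :
  0 < d -> d <= sin s -> d <= sin t ->
  Cmod (cis s - cis t) <= (1 + / d) * Rabs (cos t - cos s).
Proof.
  intros Hd Hs Ht. eapply Rle_trans; [apply Cmod_le_ReIm|].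
  unfold cis, Re, Im; simpl.
  change (Rabs (cos s - cos t) + Rabs (sin s - sin t) <=
          (1 + / d) * Rabs (cos t - cos s)).
  rewrite (Rabs_minus_sym (cos s)).
  enough (Rabs (sin s - sin t) <= / d * Rabs (cos t - cos s)) by lra.
  apply Rmult_le_reg_l with d; auto.
  rewrite <- Rmult_assoc, Rinv_r, Rmult_1_l by lra.
  assert (E : (sin s - sin t) * (sin s + sin t) =
              (cos t - cos s) * (cos t + cos s)).
  { pose proof (sin2_cos2 s). pose proof (sin2_cos2 t). unfold Rsqr in *. lra. }
  apply (f_equal Rabs) in E. rewrite !Rabs_mult in E.
  rewrite (Rabs_pos_eq (sin s + sin t)) in E by lra.
  assert (Rabs (cos t + cos s) <= 2).
  { apply Rabs_le. pose proof (COS_bound s). pose proof (COS_bound t). lra. }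
  pose proof (Rabs_pos (cos t - cos s)). pose proof (Rabs_pos (sin s - sin t)).
  nra.
Qed.

Lemma inv_bounded_of_summable (k : nat -> R) :
  (forall n, 0 < k n) -> ex_series (fun n => Rabs (k n - 1)) ->
  exists K, 0 < K /\ forall n, / k n <= K.
Proof.
  intros Hk H.
  assert (L : is_lim_seq k 1).
  { apply is_lim_seq_ext with (fun n => (k n - 1) + 1); [intros; ring|].
    replace (Finite 1) with (Finite (0 + 1)) by (f_equal; ring).
    apply is_lim_seq_plus'; [|apply is_lim_seq_const].
    apply is_lim_seq_abs_0. apply ex_series_lim_0, H. }
  assert (o1 (fun n => RtoC (/ k n - 1))).
  { apply o1_dominated with (fun n => Rabs (/ k n - 1)).
    - intros n. rewrite Cmod_R. lra.
    - apply -> (is_lim_seq_abs_0 (fun n => / k n - 1)).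
      replace (Finite 0) with (Finite (/ 1 - 1)) by (f_equal; field).
      apply is_lim_seq_minus'; [|apply is_lim_seq_const].
      apply (is_lim_seq_inv k (Finite 1)); auto. intros h; injection h; lra. }
  destruct (o1_bounded _ H0) as [K HK]. exists (Rabs K + 1). split.
  { pose proof (Rabs_pos K). lra. }
  intros n. specialize (HK n). rewrite Cmod_R in HK.
  pose proof (Rle_abs (/ k n - 1)). pose proof (Rle_abs K). lra.
Qed.

(* Variation of constants: [cp] and [cm] are defined by expanding the pair
   [(v n, k n * v (S n))] in the two model solutions [cis (- phi)], [cis phi]. *)
Lemma oscillatory_asymptotics (k t phi eta gam : nat -> R) (d : R) (v : nat -> C) :
  0 < d -> (forall n, d <= sin (t n)) ->
  ex_series (fun n => Rabs (cos (t (S n)) - cos (t n))) ->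
  (forall n, phi (S n) = phi n + t n) ->
  (forall n, 0 < k n) -> ex_series (fun n => Rabs (k n - 1)) ->
  (forall n, 0 <= eta n) -> (forall n, 0 <= gam n) ->
  ex_series eta -> ex_series gam ->
  (forall n, Cmod (v n - RtoC (2 * cos (t (S n))) * v (S n)
                   + RtoC (k (S n)) * v (S (S n)))
             <= eta n * Cmod (v (S n)) + gam n) ->
  exists sp sm : C,
    o1 (fun n => v n - (sp * cis (- phi n) + sm * cis (phi n)))%C.
Proof.
  intros Hd Ht HV Hphi Hk HK He Hg Se Sg Hv.
  destruct (inv_bounded_of_summable k Hk HK) as [kap [Hkap Hkinv]].
  set (nu := fun n => cis (t n)). set (nb := fun n => cis (- t n)).
  set (Tp := fun n => cis (- phi n)). set (Tm := fun n => cis (phi n)).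
  set (g := fun n => (v n - RtoC (2 * cos (t (S n))) * v (S n)
                   + RtoC (k (S n)) * v (S (S n)))%C).
  assert (Hdiff : forall n, 2 * d <= Cmod (nu n - nb n)).
  { intros n. unfold nu, nb. rewrite Cmod_cis_minus_conj.
    specialize (Ht n). rewrite Rabs_pos_eq; lra. }
  assert (Hne : forall n, (nb n - nu n)%C <> RtoC 0).
  { intros n. apply Cmod_gt_0. rewrite Cmod_minus_sym. specialize (Hdiff n). lra. }
  assert (Tpm : forall n, (Tp n * Tm n)%C = RtoC 1) by (intros; apply cis_opp_mult).
  assert (nbnu : forall n, (nb n * nu n)%C = RtoC 1) by (intros; apply cis_opp_mult).
  assert (TpS : forall n, Tp (S n) = (Tp n * nb n)%C).
  { intros n. unfold Tp, nb. rewrite Hphi, Ropp_plus_distr. apply cis_plus. }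
  assert (TmS : forall n, Tm (S n) = (Tm n * nu n)%C).
  { intros n. unfold Tm, nu. rewrite Hphi. apply cis_plus. }
  assert (mTp : forall n, Cmod (Tp n) = 1) by (intros; apply Cmod_cis).
  assert (mTm : forall n, Cmod (Tm n) = 1) by (intros; apply Cmod_cis).
  assert (mnu : forall n, Cmod (nu n) = 1) by (intros; apply Cmod_cis).
  assert (mnb : forall n, Cmod (nb n) = 1) by (intros; apply Cmod_cis).
  set (cp := fun n => ((RtoC (k n) * v (S n) - nu n * v n) / (nb n - nu n) * Tm n)%C).
  set (cm := fun n => ((nb n * v n - RtoC (k n) * v (S n)) / (nb n - nu n) * Tp n)%C).
  assert (cpT : forall n, (cp n * Tp n)%C =
    ((RtoC (k n) * v (S n) - nu n * v n) / (nb n - nu n))%C).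
  { intros n. unfold cp. rewrite <- Cmult_assoc, (Cmult_comm (Tm n)), Tpm. ring. }
  assert (cmT : forall n, (cm n * Tm n)%C =
    ((nb n * v n - RtoC (k n) * v (S n)) / (nb n - nu n))%C).
  { intros n. unfold cm. rewrite <- Cmult_assoc, Tpm. ring. }
  assert (F1 : forall n, v n = (cp n * Tp n + cm n * Tm n)%C).
  { intros n. rewrite cpT, cmT. field. apply Hne. }
  assert (F2 : forall n, (RtoC (k n) * v (S n))%C =
                         (cp n * Tp (S n) + cm n * Tm (S n))%C).
  { intros n. rewrite TpS, TmS, !Cmult_assoc, cpT, cmT. field. apply Hne. }
  (* [x] and [y] are the two sides of a linear system for the increments of [cp] and [cm]. The
     values of [v (S n)] read off from [F2] at [n] and from [F1] at [S n] disagree by the factor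
     [k n], which gives [x]. Comparing [v n] with the predecessor that the unperturbed recurrence at
     [S n] predicts gives [y]. The determinant is [nu (S n) - nb (S n)] up to a unimodular factor
     and sign. *)
  set (y := fun n => (- g n + cp n * Tp (S n) * (nu n - nu (S n))
                      + cm n * Tm (S n) * (nb n - nb (S n)))%C).
  set (x := fun n => (RtoC (1 - k n) * v (S n))%C).
  assert (X : forall n, x n = ((cp (S n) - cp n) * Tp (S n) +
                               (cm (S n) - cm n) * Tm (S n))%C).
  { intros n. unfold x. rewrite RtoC_minus.
    replace ((1 - RtoC (k n)) * v (S n))%C
      with (v (S n) - RtoC (k n) * v (S n))%C by ring.
    rewrite F2, (F1 (S n)). ring. }
  assert (Y : forall n, y n = ((cp (S n) - cp n) * Tp (S n) * nu (S n) +
                               (cm (S n) - cm n) * Tm (S n) * nb (S n))%C).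
  { intros n. unfold y, g. rewrite <- cis_sum. fold (nu (S n)) (nb (S n)).
    rewrite F2, (TpS (S n)), (TmS (S n)).
    replace (v n) with (cp n * Tp (S n) * nu n + cm n * Tm (S n) * nb n)%C.
    - rewrite (F1 (S n)). ring.
    - rewrite (F1 n), TpS, TmS.
      replace (cp n * (Tp n * nb n) * nu n + cm n * (Tm n * nu n) * nb n)%C
        with ((cp n * Tp n + cm n * Tm n) * (nb n * nu n))%C by ring.
      rewrite nbnu. ring. }
  assert (Dp : forall n, 2 * d * Cmod (cp (S n) - cp n) <= Cmod (x n) + Cmod (y n)).
  { intros n.
    replace (Cmod (cp (S n) - cp n)) with (Cmod ((cp (S n) - cp n) * Tp (S n)))
      by (rewrite Cmod_mult, mTp; ring).
    rewrite Rmult_comm. apply Rle_trans with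
      (Cmod ((cp (S n) - cp n) * Tp (S n)) * Cmod (nu (S n) - nb (S n))).
    { apply Rmult_le_compat_l; [apply Cmod_ge_0|apply Hdiff]. }
    rewrite <- Cmod_mult.
    replace ((cp (S n) - cp n) * Tp (S n) * (nu (S n) - nb (S n)))%C
      with (y n - nb (S n) * x n)%C by (rewrite X, Y; ring).
    eapply Rle_trans; [apply Cmod_triangle_minus|].
    rewrite Cmod_mult, mnb. lra. }
  assert (Dm : forall n, 2 * d * Cmod (cm (S n) - cm n) <= Cmod (x n) + Cmod (y n)).
  { intros n.
    replace (Cmod (cm (S n) - cm n)) with (Cmod ((cm (S n) - cm n) * Tm (S n)))
      by (rewrite Cmod_mult, mTm; ring).
    rewrite Rmult_comm. apply Rle_trans with
      (Cmod ((cm (S n) - cm n) * Tm (S n)) * Cmod (nu (S n) - nb (S n))).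
    { apply Rmult_le_compat_l; [apply Cmod_ge_0|apply Hdiff]. }
    rewrite <- Cmod_mult.
    replace ((cm (S n) - cm n) * Tm (S n) * (nu (S n) - nb (S n)))%C
      with (nu (S n) * x n - y n)%C by (rewrite X, Y; ring).
    eapply Rle_trans; [apply Cmod_triangle_minus|].
    rewrite Cmod_mult, mnu. lra. }
  set (D := fun n => (1 + / d) * Rabs (cos (t (S n)) - cos (t n))).
  assert (HD1 : forall n, Cmod (nu n - nu (S n)) <= D n).
  { intros n. apply Cmod_cis_minus_le; auto. }
  assert (HD2 : forall n, Cmod (nb n - nb (S n)) <= D n).
  { intros n. unfold nb. rewrite <- !Cconj_cis, <- Cminus_conj, Cmod_conj.
    apply HD1. }
  set (W := fun n => Cmod (cp n) + Cmod (cm n)).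
  assert (W0 : forall n, 0 <= W n).
  { intros n. unfold W. pose proof (Cmod_ge_0 (cp n)).
    pose proof (Cmod_ge_0 (cm n)). lra. }
  assert (vW : forall n, Cmod (v (S n)) <= kap * W n).
  { intros n. specialize (Hk n).
    replace (v (S n)) with (RtoC (/ k n) * (RtoC (k n) * v (S n)))%C.
    - rewrite Cmod_mult, Cmod_R, Rabs_pos_eq by (apply Rlt_le, Rinv_0_lt_compat, Hk).
      apply Rmult_le_compat; auto.
      + apply Rlt_le, Rinv_0_lt_compat, Hk.
      + apply Cmod_ge_0.
      + rewrite F2. eapply Rle_trans; [apply Cmod_triangle|].
        rewrite !Cmod_mult, mTp, mTm. unfold W. lra.
    - rewrite Cmult_assoc, <- RtoC_mult, Rinv_l by lra. ring. }
  (* The three relative errors of one step: drift of the phase, deviation of [k n] from 1, and the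
     perturbation [eta n]. The last two act on [v (S n)], whence the factor [kap]. *)
  set (e := fun n => D n + kap * Rabs (k n - 1) + kap * eta n).
  assert (D0 : forall n, 0 <= D n).
  { intros n. eapply Rle_trans; [apply Cmod_ge_0 | apply HD1]. }
  assert (e0 : forall n, 0 <= e n).
  { intros n. unfold e. specialize (He n). specialize (D0 n).
    pose proof (Rabs_pos (k n - 1)). nra. }
  assert (XY : forall n, Cmod (x n) + Cmod (y n) <= e n * W n + gam n).
  { intros n.
    assert (A1 : Cmod (x n) <= Rabs (k n - 1) * (kap * W n)).
    { unfold x. rewrite Cmod_mult, Cmod_R, Rabs_minus_sym.
      apply Rmult_le_compat_l; auto. apply Rabs_pos. }
    assert (A2 : Cmod (g n) <= eta n * (kap * W n) + gam n).
    { eapply Rle_trans; [apply Hv|]. apply Rplus_le_compat_r.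
      apply Rmult_le_compat_l; auto. }
    assert (A3 : Cmod (y n) <= Cmod (g n) + D n * W n).
    { unfold y. eapply Rle_trans; [apply Cmod_triangle|].
      eapply Rle_trans; [apply Rplus_le_compat_r, Cmod_triangle|].
      rewrite Cmod_opp, !Cmod_mult, mTp, mTm. unfold W.
      pose proof (Cmod_ge_0 (cp n)). pose proof (Cmod_ge_0 (cm n)).
      specialize (HD1 n). specialize (HD2 n). nra. }
    unfold e. nra. }
  assert (Se' : ex_series e).
  { unfold e, D. repeat apply ex_series_add; apply ex_series_cmult; auto. }
  assert (Hc : forall c : nat -> C,
     (forall n, 2 * d * Cmod (c (S n) - c n) <= Cmod (x n) + Cmod (y n)) ->
     forall n, Cmod (c (S n) - c n) <= / (2 * d) * (e n * W n + gam n)).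
  { intros c H n. apply Rmult_le_reg_l with (2 * d); [lra|].
    rewrite <- Rmult_assoc, Rinv_r by lra. specialize (H n). specialize (XY n). lra. }
  pose proof (Hc cp Dp) as Bp. pose proof (Hc cm Dm) as Bm.
  (* The rate is [/ d] because [W] adds two coefficients, each of which changes at rate
     [/ (2 * d)]. *)
  destruct (gronwall W (fun n => / d * e n) (fun n => / d * gam n)) as [K [K0 HKW]]; auto.
  { intros n. apply Rmult_le_pos; auto. apply Rlt_le, Rinv_0_lt_compat, Hd. }
  { intros n. apply Rmult_le_pos; auto. apply Rlt_le, Rinv_0_lt_compat, Hd. }
  { apply ex_series_cmult; auto. }
  { apply ex_series_cmult; auto. }
  { intros n.
    assert (T : forall c : nat -> C, Cmod (c (S n)) <= Cmod (c n) + Cmod (c (S n) - c n)).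
    { intros c. replace (c (S n)) with (c n + (c (S n) - c n))%C at 1 by ring.
      apply Cmod_triangle. }
    unfold W at 1. pose proof (T cp). pose proof (T cm).
    specialize (Bp n). specialize (Bm n).
    replace ((1 + / d * e n) * W n + / d * gam n)
      with (W n + (/ (2 * d) * (e n * W n + gam n) + / (2 * d) * (e n * W n + gam n)))
      by (field; lra).
    unfold W at 1. lra. }
  assert (Cv : forall c : nat -> C,
     (forall n, Cmod (c (S n) - c n) <= / (2 * d) * (e n * W n + gam n)) ->
     exists l, o1 (fun n => c n - l)%C).
  { intros c H. apply bounded_variation_lim.
    apply ex_series_dominated with (fun n => / (2 * d) * (K * e n + gam n)).
    - intros n. split; [apply Cmod_ge_0|]. eapply Rle_trans; [apply H|].
      apply Rmult_le_compat_l; [apply Rlt_le, Rinv_0_lt_compat; lra|].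
      apply Rplus_le_compat_r. rewrite Rmult_comm.
      apply Rmult_le_compat_r; auto.
    - apply ex_series_cmult, ex_series_add; auto. apply ex_series_cmult; auto. }
  destruct (Cv cp Bp) as [sp Lp]. destruct (Cv cm Bm) as [sm Lm].
  exists sp, sm.
  apply o1_ext with (fun n => Tp n * (cp n - sp) + Tm n * (cm n - sm))%C.
  { intros n. rewrite F1. fold (Tp n) (Tm n). ring. }
  apply o1_plus; apply o1_mult_bounded with 1; auto; intros n;
    rewrite ?mTp, ?mTm; lra.
Qed.

(** * Asymptotics of sequences in the domain of the maximal operator *)

(** This is the predicate under [epsilon] in [s_coef], stated as a relation so that it can be used
    before uniqueness is known. *)
Definition has_asymptotics (am : R) (a b : nat -> R) (N0 : nat)
  (u : nat -> C) (s : C * C) : Prop :=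
  exists r, o1 r /\ forall n,
    u n = (RtoC (/ sqrt (a n)) *
           (fst s * Theta_plus am a b N0 n + snd s * Theta_minus am a b N0 n
            + r n))%C.

Section Asymptotics.

Context (am : R) (a b : nat -> R) (N0 : nat).
Context (ham : 0 < am) (ha : forall n, 0 < a n).
Context (hsum : ex_series (fun n => / a n)).
Context (hk : ex_series (fun n => Rabs (kappa am a n - 1))).
Context (hvar : ex_series (fun n => Rabs (beta am a b (S n) - beta am a b n))).
Context (hN0 : exists delta : R, 0 < delta /\
  forall n : nat, (N0 <= n)%nat -> Rabs (beta am a b n) <= 1 - delta).

Notation Tp := (Theta_plus am a b N0).
Notation Tm := (Theta_minus am a b N0).
Notation asym := (has_asymptotics am a b N0).

Lemma sqrt_a_pos n : 0 < sqrt (a n).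
Proof. apply sqrt_lt_R0, ha. Qed.

Lemma prev_a_pos n : 0 < prev am a n.
Proof. destruct n; simpl; auto. Qed.

Lemma kappa_pos n : 0 < kappa am a n.
Proof.
  unfold kappa. apply Rdiv_lt_0_compat; auto. apply sqrt_lt_R0.
  apply Rmult_lt_0_compat; [apply prev_a_pos|auto].
Qed.

Lemma Rsqrt_sqr n : sqrt (a n) * sqrt (a n) = a n.
Proof. apply sqrt_sqrt, Rlt_le, ha. Qed.

Lemma asymptotics_alt u s : asym u s <->
  o1 (fun n => RtoC (sqrt (a n)) * u n - (fst s * Tp n + snd s * Tm n))%C.
Proof.
  split.
  - intros [r [Hr H]]. apply o1_ext with r; auto. intros n. rewrite H.
    rewrite Cmult_assoc, <- RtoC_mult, Rinv_r by (apply Rgt_not_eq, sqrt_a_pos). ring.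
  - intros H. eexists. split; [exact H|]. intros n. cbv beta.
    replace (fst s * Tp n + snd s * Tm n + (RtoC (sqrt (a n)) * u n -
       (fst s * Tp n + snd s * Tm n)))%C with (RtoC (sqrt (a n)) * u n)%C by ring.
    rewrite Cmult_assoc, <- RtoC_mult, Rinv_l by (apply Rgt_not_eq, sqrt_a_pos). ring.
Qed.

Lemma Cmod_Tp n : Cmod (Tp n) = 1.
Proof. apply Cmod_cis. Qed.

Lemma Cmod_Tm n : Cmod (Tm n) = 1.
Proof. apply Cmod_cis. Qed.

Lemma Theta_mult n : (Tp n * Tm n)%C = RtoC 1.
Proof. apply cis_opp_mult. Qed.

Lemma phase_S n : (N0 <= n)%nat ->
  phase am a b N0 (S n) = phase am a b N0 n + acos (beta am a b n).
Proof. intros H. simpl. apply Nat.leb_le in H. now rewrite H. Qed.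

Lemma sin_acos_beta_lower : exists d, 0 < d /\
  forall n, (N0 <= n)%nat -> d <= sin (acos (beta am a b n)).
Proof.
  (* Here 1 - beta^2 is at least 1 - (1 - del)^2 = del (2 - del), which is at least [del] since
     [del] cannot exceed 1. *)
  destruct hN0 as [del [Hdel H]]. exists (sqrt del).
  split; [apply sqrt_lt_R0, Hdel|]. intros n Hn. specialize (H n Hn).
  apply Rabs_le_between in H.
  rewrite sin_acos by lra. apply sqrt_le_1_alt. unfold Rsqr. nra.
Qed.

Lemma cos_acos_beta n : (N0 <= n)%nat -> cos (acos (beta am a b n)) = beta am a b n.
Proof.
  intros Hn. destruct hN0 as [del [Hdel H]]. specialize (H n Hn).
  apply Rabs_le_between in H. apply cos_acos. lra.
Qed.

Lemma rescaled_recurrence (u : nat -> C) n :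
  (RtoC (sqrt (a n)) * u n
   - RtoC (2 * beta am a b (S n)) * (RtoC (sqrt (a (S n))) * u (S n))
   + RtoC (kappa am a (S n)) * (RtoC (sqrt (a (S (S n)))) * u (S (S n))))%C
  = (RtoC (/ sqrt (a n)) * jacobi a b u (S n))%C.
Proof.
  unfold beta, kappa, jacobi; simpl prev.
  rewrite !sqrt_mult by (apply Rlt_le, ha).
  pose proof (sqrt_a_pos n). pose proof (sqrt_a_pos (S n)).
  pose proof (sqrt_a_pos (S (S n))).
  rewrite !Cmult_plus_distr_l, !Cmult_assoc, <- !RtoC_mult.
  unfold Cminus.
  f_equal; [f_equal|].
  - f_equal. f_equal. rewrite <- (Rsqrt_sqr n) at 3. field. lra.
  - rewrite Copp_mult_l, <- RtoC_opp. f_equal. f_equal. field. lra.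
  - f_equal. f_equal. field. lra.
Qed.

Lemma inv_sqrt_sq n : / sqrt (a n) * / sqrt (a n) = / a n.
Proof. rewrite <- Rinv_mult. now rewrite Rsqrt_sqr. Qed.

(** One hypothesis serves two cases: solutions at [z] take [Z = Cmod z] and [w = 0], elements of the
    maximal domain take [Z = 0] and let [w] be the modulus of the image. Row 0 is left free. Both
    error terms are summable by the inequality 2pq <= p^2 + q^2. *)
Lemma asymptotics_exist (u : nat -> C) (Z : R) (w : nat -> R) :
  0 <= Z -> (forall n, 0 <= w n) -> ex_series (fun n => w n ^ 2) ->
  (forall n, Cmod (jacobi a b u (S n)) <= Z * Cmod (u (S n)) + w n) ->
  exists s, asym u s.
Proof.
  intros HZ Hw Sw Hu.
  destruct sin_acos_beta_lower as [d [Hd Hsin]].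
  assert (Hle : forall n, (N0 <= N0 + n)%nat) by (intros; lia).
  assert (HS : forall n, (N0 + S n)%nat = S (N0 + n)) by (intros; lia).
  assert (Hi : forall n, 0 < / sqrt (a n)) by (intros; apply Rinv_0_lt_compat, sqrt_a_pos).
  (* Everything is shifted by [N0]: from there on [cos (acos beta)] equals beta and [phase] grows by
     [acos beta]. The factor [/ sqrt (a (S (N0 + n)))] in [eta] converts [u] back to the rescaled
     sequence. *)
  destruct (oscillatory_asymptotics
    (fun n => kappa am a (N0 + n)) (fun n => acos (beta am a b (N0 + n)))
    (fun n => phase am a b N0 (N0 + n))
    (fun n => Z * (/ sqrt (a (N0 + n)) * / sqrt (a (S (N0 + n)))))
    (fun n => / sqrt (a (N0 + n)) * w (N0 + n)%nat) d
    (fun n => RtoC (sqrt (a (N0 + n))) * u (N0 + n)%nat)%C) as [sp [sm Hs]].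
  - exact Hd.
  - intros n. apply Hsin, Hle.
  - apply ex_series_ext with
      (fun n => Rabs (beta am a b (S (N0 + n)) - beta am a b (N0 + n))).
    + intros n. rewrite !cos_acos_beta by lia. now rewrite HS.
    + apply (ex_series_shift _ N0 hvar).
  - intros n. rewrite HS. apply phase_S, Hle.
  - intros n. apply kappa_pos.
  - apply (ex_series_shift _ N0 hk).
  - intros n. apply Rmult_le_pos; auto. apply Rmult_le_pos; apply Rlt_le, Hi.
  - intros n. apply Rmult_le_pos; auto. apply Rlt_le, Hi.
  - apply (ex_series_cmult Z (fun n => / sqrt (a (N0 + n)) * / sqrt (a (S (N0 + n))))).
    apply ex_series_dominated with (fun n => / a (N0 + n)%nat + / a (S (N0 + n))).
    + intros n. pose proof (Hi (N0 + n)%nat). pose proof (Hi (S (N0 + n))).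
      rewrite <- !inv_sqrt_sq.
      set (p := / sqrt (a (N0 + n))) in *. set (q := / sqrt (a (S (N0 + n)))) in *.
      pose proof (Rle_0_sqr (p - q)). unfold Rsqr in *. nra.
    + apply ex_series_add.
      * apply (ex_series_shift _ N0 hsum).
      * apply (ex_series_shift (fun n => / a (S n)) N0).
        apply (ex_series_shift _ 1 hsum).
  - apply ex_series_dominated with (fun n => / a (N0 + n)%nat + w (N0 + n)%nat ^ 2).
    + intros n. pose proof (Hi (N0 + n)%nat). pose proof (Hw (N0 + n)%nat).
      rewrite <- !inv_sqrt_sq.
      set (p := / sqrt (a (N0 + n))) in *. set (q := w (N0 + n)%nat) in *.
      pose proof (Rle_0_sqr (p - q)). unfold Rsqr in *. nra.
    + apply ex_series_add.
      * apply (ex_series_shift _ N0 hsum).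
      * apply (ex_series_shift (fun n => w n ^ 2) N0 Sw).
  - intros n. cbv beta. rewrite !HS, cos_acos_beta by lia.
    rewrite rescaled_recurrence, !Cmod_mult, !Cmod_R.
    rewrite !Rabs_pos_eq by (apply Rlt_le; first [apply Hi | apply sqrt_a_pos]).
    eapply Rle_trans.
    + apply Rmult_le_compat_l; [apply Rlt_le, Hi|]. apply Hu.
    + apply Req_le. field. split; apply Rgt_not_eq, sqrt_a_pos.
  - exists (sp, sm). apply asymptotics_alt. simpl fst; simpl snd.
    apply (is_lim_seq_incr_n _ N0).
    eapply is_lim_seq_ext; [|exact Hs].
    intros n. cbv beta. now rewrite (Nat.add_comm n N0).
Qed.

(** The values at [n] and [S n] form a 2x2 system in [x] and [y]. Its determinant is 2i sin(arccos
    beta_n), which stays away from 0, so Cramer's rule carries the limit 0 over to the constants [x]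
    and [y]. *)
Lemma Theta_combination_o1 (x y : C) :
  o1 (fun n => x * Tp n + y * Tm n)%C -> x = RtoC 0 /\ y = RtoC 0.
Proof.
  intros H. destruct sin_acos_beta_lower as [d [Hd Hsin]].
  pose proof (o1_incr _ H) as H1. cbv beta in H1.
  set (r := fun n => (x * Tp n + y * Tm n)%C) in *.
  change (o1 (fun n => r (S n))) in H1.
  assert (E : forall n, (N0 <= n)%nat ->
    (Tp n * Tm (S n) - Tp (S n) * Tm n)%C =
    (cis (acos (beta am a b n)) - cis (- acos (beta am a b n)))%C).
  { intros n Hn. unfold Theta_plus, Theta_minus. rewrite phase_S by auto.
    rewrite Ropp_plus_distr, !cis_plus.
    replace (cis (- phase am a b N0 n) * (cis (phase am a b N0 n) * cis (acos (beta am a b n))) -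
      cis (- phase am a b N0 n) * cis (- acos (beta am a b n)) * cis (phase am a b N0 n))%C
    with ((cis (- phase am a b N0 n) * cis (phase am a b N0 n)) *
          (cis (acos (beta am a b n)) - cis (- acos (beta am a b n))))%C by ring.
    rewrite cis_opp_mult. ring. }
  assert (L : forall n, (N0 <= n)%nat ->
     2 * d <= Cmod (Tp n * Tm (S n) - Tp (S n) * Tm n)).
  { intros n Hn. rewrite E by auto. rewrite Cmod_cis_minus_conj.
    specialize (Hsin n Hn). rewrite Rabs_pos_eq; lra. }
  assert (Q : forall c q, o1 q ->
     (forall n, q n = (c * (Tp n * Tm (S n) - Tp (S n) * Tm n))%C) -> c = RtoC 0).
  { intros c q Hq Hc. apply o1_const.
    apply (is_lim_seq_incr_n _ N0).
    apply (is_lim_seq_incr_n _ N0) in Hq.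
    apply is_lim_seq_le_le with (fun _ => 0) (fun n => / (2 * d) * Cmod (q (n + N0)%nat)).
    - intros n. split; [apply Cmod_ge_0|]. rewrite Hc, Cmod_mult.
      apply Rmult_le_reg_l with (2 * d); [lra|].
      rewrite <- Rmult_assoc, Rinv_r, Rmult_1_l by lra.
      rewrite Rmult_comm. apply Rmult_le_compat_l; [apply Cmod_ge_0|].
      apply L. lia.
    - apply is_lim_seq_const.
    - replace (Finite 0) with (Finite (/ (2 * d) * 0)) by (f_equal; ring).
      apply (is_lim_seq_scal_l _ (/ (2 * d)) (Finite 0)). exact Hq. }
  assert (mTp := Cmod_Tp). assert (mTm := Cmod_Tm).
  split.
  - apply Q with (fun n => Tm (S n) * r n + - (Tm n * r (S n)))%C.
    + apply o1_plus.
      * apply o1_mult_bounded with 1; auto. intros n; rewrite mTm; lra.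
      * apply o1_opp. apply (o1_mult_bounded (fun n => r (S n)) Tm 1); auto.
        intros n; rewrite mTm; lra.
    + intros n. unfold r. ring.
  - apply Q with (fun n => Tp n * r (S n) + - (Tp (S n) * r n))%C.
    + apply o1_plus.
      * apply (o1_mult_bounded (fun n => r (S n)) Tp 1); auto.
        intros n; rewrite mTp; lra.
      * apply o1_opp. apply (o1_mult_bounded r (fun n => Tp (S n)) 1); auto.
        intros n; rewrite mTp; lra.
    + intros n. unfold r. ring.
Qed.

Lemma asymptotics_unique u s s' : asym u s -> asym u s' -> s = s'.
Proof.
  intros H H'. apply asymptotics_alt in H. apply asymptotics_alt in H'.
  destruct s as [x y], s' as [x' y']; simpl in *.
  destruct (Theta_combination_o1 (x - x') (y - y')) as [E1 E2].
  - eapply o1_ext; [|apply (o1_plus _ _ H' (o1_opp _ H))].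
    intros n. cbv beta. ring.
  - f_equal.
    + replace x with ((x - x') + x')%C by ring. rewrite E1. ring.
    + replace y with ((y - y') + y')%C by ring. rewrite E2. ring.
Qed.

Lemma asymptotics_linear u v s s' (c : C) :
  asym u s -> asym v s' ->
  asym (fun n => u n + c * v n)%C (fst s + c * fst s', snd s + c * snd s')%C.
Proof.
  rewrite !asymptotics_alt. intros H H'.
  assert (H1 : o1 (fun n => c * (RtoC (sqrt (a n)) * v n -
    (fst s' * Tp n + snd s' * Tm n)))%C).
  { apply (o1_mult_bounded _ (fun _ => c) (Cmod c)); auto. intros; lra. }
  eapply o1_ext; [|apply (o1_plus _ _ H H1)].
  intros n. simpl. ring.
Qed.

Lemma asymptotics_zero : asym (fun _ => RtoC 0) (RtoC 0, RtoC 0).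
Proof.
  apply asymptotics_alt. apply o1_dominated with (fun _ => 0).
  - intros n. simpl. replace (_ - _)%C with (RtoC 0) by ring. rewrite Cmod_0. lra.
  - apply is_lim_seq_const.
Qed.

Lemma asymptotics_scal u s (c : C) :
  asym u s -> asym (fun n => c * u n)%C (c * fst s, c * snd s)%C.
Proof.
  intros H. pose proof (asymptotics_linear _ _ _ _ c asymptotics_zero H) as H1.
  simpl in H1. rewrite !Cplus_0_l in H1.
  replace (fun n => c * u n)%C with (fun n => 0 + c * u n)%C; auto.
  apply functional_extensionality; intros; ring.
Qed.

Lemma asymptotics_conj u s :
  asym u s -> asym (fun n => Cconj (u n)) (Cconj (snd s), Cconj (fst s)).
Proof.
  intros [r [Hr H]]. exists (fun n => Cconj (r n)). split.
  - eapply is_lim_seq_ext; [|exact Hr]. intros n. simpl. now rewrite Cmod_conj.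
  - intros n. rewrite H, Cmult_conj, !Cplus_conj, !Cmult_conj. simpl.
    unfold Theta_plus, Theta_minus. rewrite !Cconj_cis, Ropp_involutive.
    rewrite Cconj_RtoC. ring.
Qed.

Lemma s_coef_eq u s : asym u s -> s_coef am a b N0 u = s.
Proof.
  intros H. apply (asymptotics_unique u); auto.
  apply (epsilon_spec (inhabits (RtoC 0, RtoC 0)) (asym u)). now exists s.
Qed.

Lemma asymptotics_bounded u s : asym u s ->
  exists K, 0 <= K /\ forall n, Cmod (RtoC (sqrt (a n)) * u n) <= K.
Proof.
  intros H. apply asymptotics_alt in H.
  destruct (o1_bounded _ H) as [K HK].
  exists (Rabs K + (Cmod (fst s) + Cmod (snd s))). split.
  { pose proof (Rabs_pos K). pose proof (Cmod_ge_0 (fst s)).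
    pose proof (Cmod_ge_0 (snd s)). lra. }
  intros n. specialize (HK n). cbv beta in HK. pose proof (Rle_abs K).
  set (m := (fst s * Tp n + snd s * Tm n)%C) in *.
  replace (RtoC (sqrt (a n)) * u n)%C with ((RtoC (sqrt (a n)) * u n - m) + m)%C by ring.
  eapply Rle_trans; [apply Cmod_triangle|]. apply Rplus_le_compat; [lra|].
  unfold m. eapply Rle_trans; [apply Cmod_triangle|].
  rewrite !Cmod_mult, Cmod_Tp, Cmod_Tm. lra.
Qed.

Lemma Cmod_sqrt_a_mult (u : nat -> C) n :
  Cmod (RtoC (sqrt (a n)) * u n) = sqrt (a n) * Cmod (u n).
Proof.
  rewrite Cmod_mult, Cmod_R, Rabs_pos_eq; auto. apply sqrt_pos.
Qed.

Lemma asymptotics_sq_bound u s : asym u s ->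
  exists K, 0 <= K /\ forall n, Cmod (u n) ^ 2 <= K * / a n.
Proof.
  intros H. destruct (asymptotics_bounded _ _ H) as [K [K0 HK]].
  exists (K ^ 2). split; [apply pow2_ge_0|]. intros n. specialize (HK n).
  rewrite Cmod_sqrt_a_mult in HK.
  apply Rmult_le_reg_l with (a n); auto.
  replace (a n * (K ^ 2 * / a n)) with (K ^ 2) by (field; apply Rgt_not_eq, ha).
  rewrite <- Rsqrt_sqr. replace (_ * Cmod (u n) ^ 2)
    with ((sqrt (a n) * Cmod (u n)) ^ 2) by ring.
  apply pow_incr. split; auto. apply Rmult_le_pos; [apply sqrt_pos|apply Cmod_ge_0].
Qed.

Lemma asymptotics_l2 u s : asym u s -> l2 u.
Proof.
  intros H. destruct (asymptotics_sq_bound _ _ H) as [K [K0 HK]].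
  apply ex_series_dominated with (fun n => K * / a n).
  - intros n. split; [apply pow2_ge_0|apply HK].
  - apply ex_series_cmult, hsum.
Qed.

(** The Wronskian has weight a_n, while values at [n] and [S n] are only controlled by (a_n
    a_(n+1))^(-1/2); this ratio is what remains. Passing from [n] to [S n] multiplies it by [kappa],
    and products of the [kappa] are bounded since kappa_n - 1 is summable. *)
Lemma sqrt_ratio_bounded : exists K, 0 <= K /\
  forall n, sqrt (a n) / sqrt (a (S n)) <= K.
Proof.
  apply (gronwall (fun n => sqrt (a n) / sqrt (a (S n)))
    (fun n => Rabs (kappa am a (S n) - 1)) (fun _ => 0)).
  - intros n. apply Rlt_le, Rdiv_lt_0_compat; apply sqrt_a_pos.
  - intros; apply Rabs_pos.
  - intros; lra.
  - apply (ex_series_shift _ 1 hk).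
  - apply (ex_series_ext (fun n => 0 * / a n)); [intros; apply Rmult_0_l|].
    apply ex_series_cmult, hsum.
  - intros n. rewrite Rplus_0_r.
    replace (sqrt (a (S n)) / sqrt (a (S (S n)))) with
      (kappa am a (S n) * (sqrt (a n) / sqrt (a (S n)))).
    + apply Rmult_le_compat_r.
      * apply Rlt_le, Rdiv_lt_0_compat; apply sqrt_a_pos.
      * pose proof (Rle_abs (kappa am a (S n) - 1)). lra.
    + unfold kappa; simpl prev. rewrite sqrt_mult by (apply Rlt_le, ha).
      rewrite <- (Rsqrt_sqr (S n)) at 1. field.
      repeat split; apply Rgt_not_eq, sqrt_a_pos.
Qed.

Definition wronskian (u v : nat -> C) (n : nat) : C :=
  (RtoC (a n) * (u n * v (S n) - u (S n) * v n))%C.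

(** Up to the bounded factor [tau], the Wronskian is the 2x2 determinant of the rescaled sequences.
    Replacing them by their leading parts costs o(1), and the determinant of the leading parts
    contains the factor [fst s * snd s' - snd s * fst s'], which the hypothesis makes zero. *)
Lemma wronskian_o1 u v s s' : asym u s -> asym v s' ->
  (fst s * snd s')%C = (snd s * fst s')%C -> o1 (wronskian u v).
Proof.
  intros Hu Hv E.
  destruct (asymptotics_bounded _ _ Hu) as [Ku [_ Bu]].
  apply asymptotics_alt in Hu.
  destruct (asymptotics_bounded _ _ Hv) as [Kv [_ Bv]].
  apply asymptotics_alt in Hv.
  set (X := fun n => (fst s * Tp n + snd s * Tm n)%C) in *.
  set (Y := fun n => (fst s' * Tp n + snd s' * Tm n)%C) in *.
  set (x := fun n => (RtoC (sqrt (a n)) * u n)%C) in *.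
  set (y := fun n => (RtoC (sqrt (a n)) * v n)%C) in *.
  change (o1 (fun n => x n - X n)%C) in Hu. change (o1 (fun n => y n - Y n)%C) in Hv.
  assert (BX : forall n, Cmod (X n) <= Cmod (fst s) + Cmod (snd s)).
  { intros n. unfold X. eapply Rle_trans; [apply Cmod_triangle|].
    rewrite !Cmod_mult, Cmod_Tp, Cmod_Tm. lra. }
  pose proof (o1_incr _ Hu) as Hu1. pose proof (o1_incr _ Hv) as Hv1.
  cbv beta in Hu1, Hv1.
  destruct sqrt_ratio_bounded as [K [K0 HK]].
  set (tau := fun n => RtoC (sqrt (a n) / sqrt (a (S n)))).
  assert (Hxy : o1 (fun n => X n * (y (S n) - Y (S n)) + y (S n) * (x n - X n)
     + - (X (S n) * (y n - Y n) + y n * (x (S n) - X (S n))))%C).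
  { apply o1_plus; [|apply o1_opp]; apply o1_plus.
    - apply (o1_mult_bounded _ X _ BX Hv1).
    - apply (o1_mult_bounded _ (fun n => y (S n)) Kv); auto. intros n; apply Bv.
    - apply (o1_mult_bounded _ (fun n => X (S n)) (Cmod (fst s) + Cmod (snd s))); auto.
    - apply (o1_mult_bounded _ y Kv); auto. }
  assert (Bt : forall n, Cmod (tau n) <= K).
  { intros n. unfold tau. rewrite Cmod_R, Rabs_pos_eq; auto.
    apply Rlt_le, Rdiv_lt_0_compat; apply sqrt_a_pos. }
  eapply o1_ext; [|apply (o1_mult_bounded _ tau K Bt Hxy)].
  intros n. cbv beta.
  replace (X n * (y (S n) - Y (S n)) + y (S n) * (x n - X n)
     + - (X (S n) * (y n - Y n) + y n * (x (S n) - X (S n))))%C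
    with (x n * y (S n) - x (S n) * y n - (X n * Y (S n) - X (S n) * Y n))%C by ring.
  replace (X n * Y (S n) - X (S n) * Y n)%C with
    ((fst s * snd s' - snd s * fst s') * (Tp n * Tm (S n) - Tp (S n) * Tm n))%C
    by (unfold X, Y; ring).
  rewrite E. unfold wronskian, tau, x, y.
  replace (RtoC (a n)) with
    (RtoC (sqrt (a n) / sqrt (a (S n))) * (RtoC (sqrt (a n)) * RtoC (sqrt (a (S n)))))%C.
  - ring.
  - rewrite <- !RtoC_mult. f_equal. rewrite <- (Rsqrt_sqr n) at 3. field.
    apply Rgt_not_eq, sqrt_a_pos.
Qed.

End Asymptotics.

(** * Solutions of the recurrence *)

Lemma jacobi_linear (a b : nat -> R) (u v : nat -> C) (c : C) n :
  jacobi a b (fun m => u m + c * v m)%C n =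
  (jacobi a b u n + c * jacobi a b v n)%C.
Proof. destruct n; simpl; ring. Qed.

Section Solutions.

Context (am : R) (a b : nat -> R) (N0 : nat).
Context (ham : 0 < am) (ha : forall n, 0 < a n).
Context (hsum : ex_series (fun n => / a n)).
Context (hk : ex_series (fun n => Rabs (kappa am a n - 1))).
Context (hvar : ex_series (fun n => Rabs (beta am a b (S n) - beta am a b n))).
Context (hN0 : exists delta : R, 0 < delta /\
  forall n : nat, (N0 <= n)%nat -> Rabs (beta am a b n) <= 1 - delta).

Notation asym := (has_asymptotics am a b N0).

(** Row 0 is omitted because [is_solution] leaves the value at index -1 free: as [am] is nonzero,
    that value can always be chosen to satisfy row 0. The two initial values are therefore
    independent. *)
Definition solves (z : C) (u : nat -> C) : Prop :=
  forall n, jacobi a b u (S n) = (z * u (S n))%C.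

Lemma RtoC_a_neq_0 n : RtoC (a n) <> RtoC 0.
Proof. intros h. apply RtoC_inj in h. specialize (ha n). lra. Qed.

Lemma is_solution_solves z f : is_solution am a b z f <-> solves z f.
Proof.
  split.
  - intros [f_ H] n. exact (H (S n)).
  - intros H. exists ((z * f O - RtoC (b O) * f O - RtoC (a O) * f 1%nat) / RtoC am)%C.
    intros [|n]; [|exact (H n)]. simpl. field.
    intros h; apply RtoC_inj in h; lra.
Qed.

Lemma solves_linear z u v c :
  solves z u -> solves z v -> solves z (fun n => u n + c * v n)%C.
Proof. intros Hu Hv n. rewrite jacobi_linear, Hu, Hv. ring. Qed.

Lemma solves_scal z u c : solves z u -> solves z (fun n => c * u n)%C.
Proof.
  intros Hu n. specialize (Hu n). simpl in *.
  replace (z * (c * u (S n)))%C with (c * (z * u (S n)))%C by ring.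
  rewrite <- Hu. ring.
Qed.

Lemma solves_asymptotics z u : solves z u -> exists s, asym u s.
Proof.
  intros H. apply asymptotics_exist with (Cmod z) (fun _ => 0); auto.
  - apply Cmod_ge_0.
  - intros; lra.
  - apply (ex_series_ext (fun n => 0 * / a n)); [intros; simpl; ring|].
    apply ex_series_cmult, hsum.
  - intros n. rewrite H, Cmod_mult. lra.
Qed.

Lemma solves_step z u n : solves z u ->
  u (S (S n)) = ((z * u (S n) - RtoC (b (S n)) * u (S n) - RtoC (a n) * u n)
                 / RtoC (a (S n)))%C.
Proof.
  intros H. specialize (H n). simpl in H.
  rewrite <- H. field. apply RtoC_a_neq_0.
Qed.

Lemma solves_ext z u v : solves z u -> solves z v ->
  u O = v O -> u 1%nat = v 1%nat -> forall n, u n = v n.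
Proof.
  intros Hu Hv E0 E1.
  assert (E : forall n, u n = v n /\ u (S n) = v (S n)).
  { induction n as [|n [IH1 IH2]]; auto. split; auto.
    rewrite (solves_step z u), (solves_step z v) by auto.
    now rewrite IH1, IH2. }
  intros n; apply E.
Qed.

Lemma solves_initial (z x y : C) : exists u, solves z u /\ u O = x /\ u 1%nat = y.
Proof.
  set (pr := nat_rect (fun _ => (C * C)%type) (x, y) (fun n p =>
    (snd p, ((z * snd p - RtoC (b (S n)) * snd p - RtoC (a n) * fst p)
             / RtoC (a (S n)))%C))).
  exists (fun n => fst (pr n)). split; [|split; reflexivity].
  intros n. simpl. field. apply RtoC_a_neq_0.
Qed.

Lemma wronskian_const z u v n : solves z u -> solves z v ->
  wronskian a u v n = wronskian a u v O.
Proof.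
  intros Hu Hv. induction n as [|n IH]; auto.
  rewrite <- IH. unfold wronskian.
  rewrite (solves_step z u n Hu), (solves_step z v n Hv).
  field. apply RtoC_a_neq_0.
Qed.

(** The Wronskian of [u] with any solution [v] tends to 0 and is constant, hence is 0. Since the
    initial data of [v] are arbitrary, both initial values of [u] vanish. *)
Lemma solves_asymptotics_zero z u :
  solves z u -> asym u (RtoC 0, RtoC 0) -> forall n, u n = RtoC 0.
Proof.
  intros Hu Hs.
  assert (W : forall x y : C, (u O * y - u 1%nat * x)%C = RtoC 0).
  { intros x y. destruct (solves_initial z x y) as [v [Hv [v0 v1]]].
    destruct (solves_asymptotics z v Hv) as [s' Hs'].
    assert (H : o1 (wronskian a u v)).
    { apply (wronskian_o1 am a b N0 ha hsum hk u v (RtoC 0, RtoC 0) s'); auto. simpl. ring. }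
    apply (o1_ext _ (fun _ => wronskian a u v O)) in H.
    - apply o1_const in H. unfold wronskian in H. rewrite v0, v1 in H.
      replace (u O * y - u 1%nat * x)%C with
        (/ RtoC (a O) * (RtoC (a O) * (u O * y - u 1%nat * x)))%C
        by (field; apply RtoC_a_neq_0).
      rewrite H. ring.
    - intros n. now apply wronskian_const with z. }
  apply (solves_ext z u (fun _ => RtoC 0)); auto.
  - intros n. simpl. ring.
  - rewrite <- (W (RtoC 0) (RtoC 1)). ring.
  - transitivity (- (u O * RtoC 0 - u 1%nat * RtoC 1))%C; [ring|].
    rewrite W. ring.
Qed.

(** The linear map from initial data to asymptotic pairs is injective by [solves_asymptotics_zero],
    hence bijective between spaces of dimension two. The solution is found by Cramer's rule with
    determinant [D]. *)
Lemma solves_with_asymptotics z s : exists f, solves z f /\ asym f s.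
Proof.
  destruct (solves_initial z (RtoC 1) (RtoC 0)) as [u [Hu [u0 u1]]].
  destruct (solves_initial z (RtoC 0) (RtoC 1)) as [v [Hv [v0 v1]]].
  destruct (solves_asymptotics z u Hu) as [[x y] Su].
  destruct (solves_asymptotics z v Hv) as [[x' y'] Sv].
  assert (K : forall c c' : C, (c * x + c' * x')%C = RtoC 0 ->
                           (c * y + c' * y')%C = RtoC 0 -> c = RtoC 0 /\ c' = RtoC 0).
  { intros c c' E1 E2.
    assert (Z : forall n, (c * u n + c' * v n)%C = RtoC 0).
    { apply (solves_asymptotics_zero z).
      - apply solves_linear; auto. now apply solves_scal.
      - rewrite <- E1 at 1. rewrite <- E2.
        apply (asymptotics_linear am a b N0 ha (fun n => c * u n)%C v
                 (c * x, c * y)%C (x', y')); auto.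
        apply (asymptotics_scal am a b N0 ha u (x, y)); auto. }
    split.
    - rewrite <- (Z O), u0, v0. ring.
    - rewrite <- (Z 1%nat), u1, v1. ring. }
  set (D := (x * y' - y * x')%C).
  assert (HD : D <> RtoC 0).
  (* If [D] vanished, [(y', - y)] and [(x', - x)] would lie in the kernel, so [x = y = 0]; then
     [(1, 0)] would lie there too. *)
  { intros h. destruct (K y' (- y)%C) as [E1 E2].
    { rewrite <- h. unfold D. ring. }
    { ring. }
    destruct (K (RtoC 1) (RtoC 0)) as [E3 _].
    - destruct (K x' (- x)%C) as [E5 E6].
      + ring.
      + transitivity (- D)%C; [unfold D; ring|rewrite h; ring].
      + transitivity (- - x)%C; [ring|]. rewrite E6. ring.
    - transitivity (- - y)%C; [ring|]. rewrite E2. ring.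
    - apply RtoC_inj in E3. lra. }
  destruct s as [p q].
  exists (fun n => (p * y' - q * x') / D * u n + (q * x - p * y) / D * v n)%C. split.
  - apply solves_linear; auto. now apply solves_scal.
  - replace (p, q) with
      (((p * y' - q * x') / D * x + (q * x - p * y) / D * x')%C,
       ((p * y' - q * x') / D * y + (q * x - p * y) / D * y')%C)
      by (unfold D; f_equal; field; exact HD).
    apply (asymptotics_linear am a b N0 ha (fun n => (p * y' - q * x') / D * u n)%C v
       ((p * y' - q * x') / D * x, (p * y' - q * x') / D * y)%C (x', y')); auto.
    apply (asymptotics_scal am a b N0 ha u (x, y)); auto.
Qed.

(** Because [Th] is unimodular with inverse [Th'], the relative error in [jost] and the additive
    error in [has_asymptotics] amount to the same thing. *)
Lemma asymptotics_multiplicative (Th : nat -> C) (Th' : nat -> C) s f :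
  (forall n, Th n * Th' n = RtoC 1)%C -> (forall n, Cmod (Th n) = 1) ->
  (forall n, fst s * Theta_plus am a b N0 n + snd s * Theta_minus am a b N0 n
             = Th n)%C ->
  (asym f s <-> exists r, o1 r /\
     forall n, f n = (RtoC (/ sqrt (a n)) * Th n * (1 + r n))%C).
Proof.
  intros H1 HTh E.
  assert (HTh' : forall n, Cmod (Th' n) = 1).
  { intros n. specialize (H1 n). apply (f_equal Cmod) in H1.
    rewrite Cmod_mult, HTh, Cmod_1 in H1. lra. }
  split.
  - intros [r [Hr H]]. exists (fun n => Th' n * r n)%C. split.
    + apply o1_mult_bounded with 1; auto. intros n. rewrite HTh'. lra.
    + intros n. rewrite H, E.
      replace (RtoC (/ sqrt (a n)) * Th n * (1 + Th' n * r n))%C with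
        (RtoC (/ sqrt (a n)) * (Th n + (Th n * Th' n) * r n))%C by ring.
      rewrite H1. ring.
  - intros [r [Hr H]]. exists (fun n => Th n * r n)%C. split.
    + apply o1_mult_bounded with 1; auto. intros n. rewrite HTh. lra.
    + intros n. rewrite H, E. ring.
Qed.

Lemma jost_spec (Th Th' : nat -> C) s z :
  (forall n, Th n * Th' n = RtoC 1)%C -> (forall n, Cmod (Th n) = 1) ->
  (forall n, fst s * Theta_plus am a b N0 n + snd s * Theta_minus am a b N0 n
             = Th n)%C ->
  solves z (jost am a b Th z) /\ asym (jost am a b Th z) s.
Proof.
  intros H1 H2 E.
  destruct (solves_with_asymptotics z s) as [f [Hf Sf]].
  rewrite <- is_solution_solves. rewrite (asymptotics_multiplicative Th Th') by auto.
  unfold jost. apply epsilon_spec. exists f. split.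
  - now apply is_solution_solves.
  - apply -> (asymptotics_multiplicative Th Th'); eauto.
Qed.

Lemma f_plus_spec z : solves z (f_plus am a b N0 z) /\
  asym (f_plus am a b N0 z) (RtoC 1, RtoC 0).
Proof.
  apply jost_spec with (Theta_minus am a b N0).
  - intros n; apply Theta_mult.
  - intros n; apply Cmod_Tp.
  - intros n. simpl. ring.
Qed.

Lemma f_minus_spec z : solves z (f_minus am a b N0 z) /\
  asym (f_minus am a b N0 z) (RtoC 0, RtoC 1).
Proof.
  apply jost_spec with (Theta_plus am a b N0).
  - intros n; rewrite Cmult_comm; apply Theta_mult.
  - intros n; apply Cmod_Tm.
  - intros n. simpl. ring.
Qed.

(** * The polynomials P_n(z) and their asymptotic coefficients *)

Lemma P_pair_S z n : fst (P_pair am a b z (S n)) = P am a b z n.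
Proof. unfold P. simpl. now destruct (P_pair am a b z n). Qed.

Lemma jacobi_P z n : jacobi a b (P am a b z) n = (z * P am a b z n)%C.
Proof.
  destruct n as [|n].
  - unfold jacobi, P; simpl. field. apply RtoC_a_neq_0.
  - assert (E : P am a b z (S (S n)) =
      (((z - RtoC (b (S n))) * P am a b z (S n) - RtoC (a n) * P am a b z n)
       / RtoC (a (S n)))%C).
    { rewrite <- (P_pair_S z n). unfold P.
      change (P_pair am a b z (S (S n))) with (let (p, q) := P_pair am a b z (S n) in
        (q, ((z - b (S n)) * q - prev am a (S n) * p) / a (S n))%C).
      now destruct (P_pair am a b z (S n)). }
    unfold jacobi. rewrite E. field. apply RtoC_a_neq_0.
Qed.

Lemma P_solves z : solves z (P am a b z).
Proof. intros n; apply jacobi_P. Qed.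

(** In contrast to [solves], row 0 is included here; it determines [u 1] from [u 0], so only one
    free parameter is left. *)
Lemma eigenvector_eq_P z u : (forall n, jacobi a b u n = (z * u n)%C) ->
  forall n, u n = (u O * P am a b z n)%C.
Proof.
  intros H. apply (solves_ext z).
  - intros n; apply H.
  - apply (solves_scal z), P_solves.
  - unfold P; simpl. ring.
  - specialize (H O). simpl in H. unfold P; simpl.
    replace (u 1%nat) with ((RtoC (b O) * u O + RtoC (a O) * u 1%nat
       - RtoC (b O) * u O) / RtoC (a O))%C by (field; apply RtoC_a_neq_0).
    rewrite H. field. apply RtoC_a_neq_0.
Qed.

(** This gives [sigma] the meaning used below. The expansion that [epsilon] looks for exists: with
    [s] the asymptotic pair of [P], subtracting the combination of [f_plus] and [f_minus] with
    coefficients [s] leaves a solution with pair zero, which vanishes. *)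
Lemma P_asymptotics z :
  asym (P am a b z) (sigma_plus am a b N0 z, sigma_minus am a b N0 z).
Proof.
  destruct (f_plus_spec z) as [Hp Sp]. destruct (f_minus_spec z) as [Hm Sm].
  set (fp := f_plus am a b N0 z) in *. set (fm := f_minus am a b N0 z) in *.
  assert (comb : forall s, asym (fun n => fst s * fp n + snd s * fm n)%C s).
  { intros [x y]. cbn [fst snd].
    pose proof (asymptotics_scal am a b N0 ha fp _ x Sp) as H1.
    pose proof (asymptotics_linear am a b N0 ha _ fm _ _ y H1 Sm) as H2.
    simpl in H2. rewrite !Cmult_0_r, !Cmult_1_r, Cplus_0_l, Cplus_0_r in H2.
    exact H2. }
  assert (spec : forall n, P am a b z n =
    (fst (Defs.sigma am a b N0 z) * fp n + snd (Defs.sigma am a b N0 z) * fm n)%C).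
  { unfold Defs.sigma. apply epsilon_spec.
    destruct (solves_asymptotics z _ (P_solves z)) as [s Hs]. exists s.
    fold fp fm. intros n.
    pose proof (asymptotics_linear am a b N0 ha _ _ _ _ (- (1))%C Hs (comb s)) as Hd.
    assert (Z : (P am a b z n + - (1) * (fst s * fp n + snd s * fm n))%C = RtoC 0).
    { apply (solves_asymptotics_zero z (fun n =>
        P am a b z n + - (1) * (fst s * fp n + snd s * fm n))%C).
      - apply solves_linear; [apply P_solves|].
        apply solves_linear; auto. now apply solves_scal.
      - replace (RtoC 0, RtoC 0) with ((fst s + - (1) * fst s)%C, (snd s + - (1) * snd s)%C);
          auto. f_equal; ring. }
    replace (P am a b z n) with ((P am a b z n + - (1) * (fst s * fp n + snd s * fm n))
      + (fst s * fp n + snd s * fm n))%C by ring.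
    rewrite Z. ring. }
  unfold sigma_plus, sigma_minus.
  replace (P am a b z) with (fun n => fst (Defs.sigma am a b N0 z) * fp n
    + snd (Defs.sigma am a b N0 z) * fm n)%C
    by (apply functional_extensionality; intros; now rewrite spec).
  rewrite <- surjective_pairing. apply comb.
Qed.

End Solutions.

(** * The Hilbert space of square-summable sequences *)

Definition csum (f : nat -> C) : C :=
  (Series (fun n => Re (f n)), Series (fun n => Im (f n))).

Definition abs_summable (f : nat -> C) : Prop := ex_series (fun n => Cmod (f n)).

Definition sqnorm (u : nat -> C) : R := Series (fun n => Cmod (u n) ^ 2).

Lemma abs_summable_Re f : abs_summable f -> ex_series (fun n => Re (f n)).
Proof.
  intros H. apply ex_series_Rabs, ex_series_dominated with (2 := H).
  intros n. split; [apply Rabs_pos|apply re_le_Cmod].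
Qed.

Lemma abs_summable_Im f : abs_summable f -> ex_series (fun n => Im (f n)).
Proof.
  intros H. apply ex_series_Rabs, ex_series_dominated with (2 := H).
  intros n. split; [apply Rabs_pos|apply Im_le_Cmod].
Qed.

Lemma csum_ext f g : (forall n, f n = g n) -> csum f = csum g.
Proof. intros H. replace f with g; auto. now apply functional_extensionality. Qed.

Lemma csum_plus f g : abs_summable f -> abs_summable g ->
  csum (fun n => f n + g n)%C = (csum f + csum g)%C.
Proof.
  intros Hf Hg. unfold csum, Cplus; simpl. f_equal.
  - apply Series_plus; now apply abs_summable_Re.
  - apply Series_plus; now apply abs_summable_Im.
Qed.

Lemma csum_scal c f : abs_summable f -> csum (fun n => c * f n)%C = (c * csum f)%C.
Proof.
  intros Hf. unfold csum, Cmult; simpl.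
  pose proof (abs_summable_Re f Hf). pose proof (abs_summable_Im f Hf).
  f_equal.
  - rewrite <- !Series_scal_l, <- Series_minus by now apply ex_series_cmult.
    reflexivity.
  - rewrite <- !Series_scal_l, <- Series_plus by now apply ex_series_cmult.
    reflexivity.
Qed.

Lemma csum_conj f : csum (fun n => Cconj (f n)) = Cconj (csum f).
Proof.
  unfold csum, Cconj; simpl. f_equal. rewrite <- Series_opp. reflexivity.
Qed.

(** Meant for series whose partial sums have a closed form, such as telescoping ones; convergence of
    these sums suffices. *)
Lemma csum_of_partial_sums (f s : nat -> C) (l : C) :
  s O = f O -> (forall n, s (S n) = s n + f (S n))%C ->
  o1 (fun n => s n - l)%C -> csum f = l.
Proof.
  intros S0 SS H.
  assert (ERe : forall n, Re (s n) = sum_n (fun n => Re (f n)) n).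
  { induction n as [|n IH].
    - now rewrite sum_O, S0.
    - rewrite sum_Sn, SS, <- IH. reflexivity. }
  assert (EIm : forall n, Im (s n) = sum_n (fun n => Im (f n)) n).
  { induction n as [|n IH].
    - now rewrite sum_O, S0.
    - rewrite sum_Sn, SS, <- IH. reflexivity. }
  assert (L : forall x y : R, forall g : nat -> R,
     (forall n, Rabs (g n - x) <= Cmod (s n - l)) -> is_lim_seq g x).
  { intros x _ g Hg.
    apply is_lim_seq_ext with (fun n => (g n - x) + x); [intros; ring|].
    replace (Finite x) with (Finite (0 + x)) by (f_equal; ring).
    apply is_lim_seq_plus'; [|apply is_lim_seq_const].
    apply is_lim_seq_abs_0.
    apply is_lim_seq_le_le with (fun _ => 0) (fun n => Cmod (s n - l)); auto.
    - intros n; split; [apply Rabs_pos|apply Hg].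
    - apply is_lim_seq_const. }
  rewrite (surjective_pairing l). unfold csum. f_equal; apply is_series_unique.
  - apply (L _ 0). intros n. rewrite <- ERe. apply (re_le_Cmod (s n - l)).
  - apply (L _ 0). intros n. rewrite <- EIm. apply (Im_le_Cmod (s n - l)).
Qed.

Lemma Cmod_csum_le f : abs_summable f -> Cmod (csum f) <= Series (fun n => Cmod (f n)).
Proof.
  intros Hf. set (S := csum f).
  destruct (Req_dec (Cmod S) 0) as [h|h].
  { rewrite h. apply Series_nonneg; auto. intros; apply Cmod_ge_0. }
  assert (HS : 0 < Cmod S) by (pose proof (Cmod_ge_0 S); lra).
  (* [c] rotates the sum onto the positive half-line *)
  set (c := (RtoC (/ Cmod S) * Cconj S)%C).
  assert (Hc : Cmod c = 1).
  { unfold c. rewrite Cmod_mult, Cmod_conj, Cmod_R, Rabs_pos_eq.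
    - field; auto.
    - apply Rlt_le, Rinv_0_lt_compat, HS. }
  assert (E : (c * S)%C = RtoC (Cmod S)).
  { unfold c. replace (RtoC (/ Cmod S) * Cconj S * S)%C with
      (RtoC (/ Cmod S) * (S * Cconj S))%C by ring.
    rewrite <- Cmod2_conj, <- RtoC_mult. f_equal. field; auto. }
  replace (Cmod S) with (Re (c * S)%C) by (rewrite E; reflexivity).
  unfold S. rewrite <- csum_scal by auto. simpl.
  apply Rle_trans with (Series (fun n => Rabs (Re (c * f n)))).
  - eapply Rle_trans; [apply Rle_abs|]. apply Series_Rabs.
    apply ex_series_dominated with (2 := Hf). intros n. split; [apply Rabs_pos|].
    eapply Rle_trans; [apply re_le_Cmod|]. rewrite Cmod_mult, Hc. lra.
  - apply Series_le; auto. intros n. split; [apply Rabs_pos|].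
    eapply Rle_trans; [apply re_le_Cmod|]. rewrite Cmod_mult, Hc. lra.
Qed.

Lemma l2_mult u v : l2 u -> l2 v -> abs_summable (fun n => u n * Cconj (v n))%C.
Proof.
  intros Hu Hv. apply ex_series_dominated with
    (fun n => Cmod (u n) ^ 2 + Cmod (v n) ^ 2).
  - intros n. split; [apply Cmod_ge_0|]. rewrite Cmod_mult, Cmod_conj.
    pose proof (Rle_0_sqr (Cmod (u n) - Cmod (v n))). unfold Rsqr in *.
    pose proof (Cmod_ge_0 (u n)). pose proof (Cmod_ge_0 (v n)). nra.
  - now apply ex_series_add.
Qed.

Lemma l2_linear u v c : l2 u -> l2 v -> l2 (fun n => u n + c * v n)%C.
Proof.
  intros Hu Hv. apply ex_series_dominated with
    (fun n => 2 * Cmod (u n) ^ 2 + 2 * Cmod c ^ 2 * Cmod (v n) ^ 2).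
  - intros n. split; [apply pow2_ge_0|].
    apply Rle_trans with ((Cmod (u n) + Cmod c * Cmod (v n)) ^ 2).
    + apply pow_incr. split; [apply Cmod_ge_0|]. rewrite <- Cmod_mult.
      apply Cmod_triangle.
    + pose proof (Rle_0_sqr (Cmod (u n) - Cmod c * Cmod (v n))). unfold Rsqr in *. nra.
  - apply ex_series_add; now apply ex_series_cmult.
Qed.

Lemma l2_conj u : l2 u -> l2 (fun n => Cconj (u n)).
Proof.
  apply ex_series_ext. intros n. now rewrite Cmod_conj.
Qed.

Lemma l2_zero : l2 (fun _ => RtoC 0).
Proof.
  apply ex_series_of_bounded with 0.
  - intros; apply pow2_ge_0.
  - intros N. induction N.
    + rewrite sum_O, Cmod_0. lra.
    + rewrite sum_Sn, Cmod_0 in *. unfold plus; simpl in *. lra.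
Qed.

Lemma l2_scal u c : l2 u -> l2 (fun n => c * u n)%C.
Proof.
  intros Hu. replace (fun n => c * u n)%C with (fun n => 0 + c * u n)%C.
  - apply l2_linear; auto. apply l2_zero.
  - apply functional_extensionality; intros; ring.
Qed.

Lemma inner_linear_l u v w c : l2 u -> l2 v -> l2 w ->
  inner (fun n => u n + c * v n)%C w = (inner u w + c * inner v w)%C.
Proof.
  intros Hu Hv Hw.
  change (csum (fun n => (u n + c * v n) * Cconj (w n))%C =
    (csum (fun n => u n * Cconj (w n))%C + c * csum (fun n => v n * Cconj (w n))%C)%C).
  pose proof (l2_mult u w Hu Hw) as H1. pose proof (l2_mult v w Hv Hw) as H2.
  rewrite <- csum_scal, <- csum_plus; auto.
  - apply csum_ext. intros n. ring.
  - eapply ex_series_ext; [|apply (ex_series_cmult (Cmod c)), H2].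
    intros n. cbv beta. now rewrite (Cmod_mult c).
Qed.

Lemma inner_scal_l u w c : l2 u -> l2 w ->
  inner (fun n => c * u n)%C w = (c * inner u w)%C.
Proof.
  intros Hu Hw.
  change (csum (fun n => (c * u n) * Cconj (w n))%C =
    (c * csum (fun n => u n * Cconj (w n)))%C).
  rewrite <- csum_scal by now apply l2_mult.
  apply csum_ext. intros n. ring.
Qed.

Lemma inner_conj u v : inner v u = Cconj (inner u v).
Proof.
  change (csum (fun n => v n * Cconj (u n))%C = Cconj (csum (fun n => u n * Cconj (v n))%C)).
  rewrite <- csum_conj. apply csum_ext. intros n.
  rewrite Cmult_conj, Cconj_conj. ring.
Qed.

Lemma inner_linear_r u v w c : l2 u -> l2 v -> l2 w ->
  inner w (fun n => u n + c * v n)%C = (inner w u + Cconj c * inner w v)%C.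
Proof.
  intros Hu Hv Hw.
  rewrite inner_conj, inner_linear_l, Cplus_conj, Cmult_conj by auto.
  now rewrite <- !inner_conj.
Qed.

Lemma inner_self u : inner u u = RtoC (sqnorm u).
Proof.
  unfold inner, sqnorm, RtoC. f_equal.
  - apply Series_ext. intros n. rewrite <- Cmod2_conj. reflexivity.
  - rewrite (Series_ext _ (fun _ => 0 * 0)).
    + rewrite Series_scal_l. ring.
    + intros n. rewrite <- Cmod2_conj. simpl. ring.
Qed.

Lemma sqnorm_ge_0 u : l2 u -> 0 <= sqnorm u.
Proof. intros H. apply Series_nonneg; auto. intros; apply pow2_ge_0. Qed.

Lemma l2_norm_sqr u : l2 u -> l2_norm u ^ 2 = sqnorm u.
Proof.
  intros H. unfold l2_norm. rewrite <- Rsqr_pow2. apply Rsqr_sqrt, sqnorm_ge_0, H.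
Qed.

Lemma Cauchy_Schwarz u v : l2 u -> l2 v ->
  Cmod (inner u v) ^ 2 <= sqnorm u * sqnorm v.
Proof.
  intros Hu Hv. set (S := Series (fun n => Cmod (u n) * Cmod (v n))).
  assert (Sm : ex_series (fun n => Cmod (u n) * Cmod (v n))).
  { eapply ex_series_ext; [|apply (l2_mult u v Hu Hv)]. intros n. cbv beta.
    now rewrite Cmod_mult, Cmod_conj. }
  assert (HS : Cmod (inner u v) <= S).
  { eapply Rle_trans; [apply (Cmod_csum_le _ (l2_mult u v Hu Hv))|].
    apply Req_le, Series_ext. intros n. now rewrite Cmod_mult, Cmod_conj. }
  assert (S0 : 0 <= S) by (pose proof (Cmod_ge_0 (inner u v)); lra).
  assert (Q : forall t, 0 <= sqnorm u + (- (2 * t) * S + t ^ 2 * sqnorm v)).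
  { intros t. unfold sqnorm, S.
    rewrite <- !Series_scal_l.
    rewrite <- !Series_plus; auto; try apply ex_series_add; try apply ex_series_cmult; auto.
    apply Series_nonneg.
    - intros n. pose proof (pow2_ge_0 (Cmod (u n) - t * Cmod (v n))). lra.
    - apply ex_series_add; auto. apply ex_series_add; now apply ex_series_cmult. }
  apply Rle_trans with (S ^ 2).
  { apply pow_incr. split; auto. apply Cmod_ge_0. }
  pose proof (sqnorm_ge_0 u Hu) as A0. pose proof (sqnorm_ge_0 v Hv) as B0.
  destruct (Req_dec (sqnorm v) 0) as [h|h].
  (* For [sqnorm v = 0] the polynomial is affine in [t], and this [t] would give it the value -1
     unless [S = 0]. In the other case [S / sqnorm v] is its minimum point. *)
  - specialize (Q ((sqnorm u + 1) / (2 * S))). rewrite h in *.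
    destruct (Req_dec S 0) as [->|hS]; [lra|].
    replace (- (2 * ((sqnorm u + 1) / (2 * S))) * S) with (- (sqnorm u + 1)) in Q
      by (field; auto). lra.
  - specialize (Q (S / sqnorm v)).
    replace (sqnorm u + (- (2 * (S / sqnorm v)) * S + (S / sqnorm v) ^ 2 * sqnorm v))
      with (sqnorm u - S ^ 2 / sqnorm v) in Q by (field; auto).
    apply Rmult_le_reg_r with (/ sqnorm v).
    + apply Rinv_0_lt_compat. lra.
    + replace (sqnorm u * sqnorm v * / sqnorm v) with (sqnorm u) by (field; auto).
      unfold Rdiv in Q. lra.
Qed.

Lemma inner_le_l2_norm u v : l2 u -> l2 v ->
  Cmod (inner u v) <= l2_norm u * l2_norm v.
Proof.
  intros Hu Hv. apply Rsqr_incr_0_var.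
  - rewrite !Rsqr_pow2, Rpow_mult_distr, !l2_norm_sqr by auto. now apply Cauchy_Schwarz.
  - apply Rmult_le_pos; apply sqrt_pos.
Qed.

Lemma sqnorm_minus_projection w e : l2 w -> l2 e -> inner e e = RtoC 1 ->
  sqnorm (fun n => w n + - inner w e * e n)%C = sqnorm w - Cmod (inner w e) ^ 2.
Proof.
  intros Hw He E. apply RtoC_inj. rewrite <- inner_self.
  set (c := (- inner w e)%C).
  assert (Hl : l2 (fun n => w n + c * e n)%C) by now apply l2_linear.
  rewrite inner_linear_r, !inner_linear_l, E by auto.
  rewrite inner_self, (inner_conj w e), RtoC_minus, Cmod2_conj.
  unfold c. rewrite Copp_conj. ring.
Qed.

(** The projections are subtracted one at a time. Each lowers the squared norm by the square of one
    coefficient, leaves the later coefficients unchanged by orthogonality, and the squared norm of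
    the residue [w] stays nonnegative. *)
Lemma Bessel_inequality (e : nat -> nat -> C) u K :
  (forall k, l2 (e k)) ->
  (forall j k, inner (e j) (e k) = if Nat.eqb j k then RtoC 1 else RtoC 0) ->
  l2 u -> sum_n (fun k => Cmod (inner u (e k)) ^ 2) K <= sqnorm u.
Proof.
  intros He Ho Hu.
  assert (E1 : forall k, inner (e k) (e k) = RtoC 1)
    by (intros k; now rewrite Ho, Nat.eqb_refl).
  assert (E0 : forall j k, (j < k)%nat -> inner (e j) (e k) = RtoC 0).
  { intros j k Hjk. rewrite Ho. assert (j <> k) as h by lia.
    apply Nat.eqb_neq in h. now rewrite h. }
  enough (H : exists w, l2 w /\
    (forall j, (K < j)%nat -> inner w (e j) = inner u (e j)) /\
    sqnorm w = sqnorm u - sum_n (fun k => Cmod (inner u (e k)) ^ 2) K).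
  { destruct H as [w [Hw [_ H]]]. pose proof (sqnorm_ge_0 w Hw). lra. }
  assert (step : forall w k, l2 w -> (forall j, (k <= j)%nat -> inner w (e j) = inner u (e j)) ->
    exists w', l2 w' /\ (forall j, (k < j)%nat -> inner w' (e j) = inner u (e j)) /\
      sqnorm w' = sqnorm w - Cmod (inner u (e k)) ^ 2).
  { intros w k Hw Hk. exists (fun n => w n + - inner w (e k) * e k n)%C. split; [|split].
    - now apply l2_linear.
    - intros j Hj. rewrite inner_linear_l, E0, Hk by (auto; lia). ring.
    - rewrite sqnorm_minus_projection by auto. now rewrite Hk. }
  induction K as [|K [w [Hw [IH1 IH2]]]].
  - rewrite sum_O. apply step; auto.
  - destruct (step w (S K) Hw IH1) as [w' [H1 [H2 H3]]].
    exists w'. split; [|split]; auto. rewrite H3, IH2, sum_Sn.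
    unfold plus; simpl. ring.
Qed.

(** The sum of [g m * h m], with the conjugation in [inner] undone. The Green kernel is symmetric,
    not Hermitian, for complex [z], so it must be paired linearly in both arguments; going through
    [inner] keeps the Cauchy-Schwarz inequality available. *)
Definition bilinear (g h : nat -> C) : C := inner g (fun m => Cconj (h m)).

Lemma bilinear_linear_r g h k c : l2 g -> l2 h -> l2 k ->
  bilinear g (fun m => h m + c * k m)%C = (bilinear g h + c * bilinear g k)%C.
Proof.
  intros Hg Hh Hk. unfold bilinear.
  replace (fun m => Cconj (h m + c * k m)) with
    (fun m => Cconj (h m) + Cconj c * Cconj (k m))%C.
  - rewrite inner_linear_r, Cconj_conj by (auto; now apply l2_conj). reflexivity.
  - apply functional_extensionality. intros m. now rewrite Cplus_conj, Cmult_conj.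
Qed.

Lemma bilinear_scal_r g h c : l2 g -> l2 h ->
  bilinear g (fun m => c * h m)%C = (c * bilinear g h)%C.
Proof.
  intros Hg Hh. unfold bilinear.
  rewrite inner_conj, (inner_conj (fun m => Cconj (h m))).
  replace (fun m => Cconj (c * h m)) with (fun m => Cconj c * Cconj (h m))%C.
  - rewrite inner_scal_l, Cmult_conj, Cconj_conj by (auto; now apply l2_conj).
    reflexivity.
  - apply functional_extensionality. intros m. now rewrite Cmult_conj.
Qed.

Lemma bilinear_delta g n :
  bilinear g (fun m => if Nat.eqb m n then RtoC 1 else RtoC 0) = g n.
Proof.
  apply (csum_of_partial_sums _ (fun N => if Nat.leb n N then g n else RtoC 0)).
  - destruct n; simpl; rewrite Cconj_conj; ring.
  - intros N. cbv beta. rewrite Cconj_conj.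
    destruct (Nat.leb_spec n (S N)); destruct (Nat.leb_spec n N);
      destruct (Nat.eqb_spec (S N) n); try lia; subst; ring.
  - apply (is_lim_seq_incr_n _ n).
    apply is_lim_seq_ext with (fun _ => 0); [|apply is_lim_seq_const].
    intros N. replace (n <=? N + n)%nat with true.
    + replace (g n - g n)%C with (RtoC 0) by ring. now rewrite Cmod_0.
    + symmetry. apply Nat.leb_le. lia.
Qed.

(** * Hilbert-Schmidt kernels *)

Lemma Series_sum_n (f : nat -> nat -> R) K : (forall k, ex_series (f k)) ->
  ex_series (fun n => sum_n (fun k => f k n) K) /\
  Series (fun n => sum_n (fun k => f k n) K) = sum_n (fun k => Series (f k)) K.
Proof.
  intros H. induction K as [|K [IH1 IH2]].
  - split.
    + eapply ex_series_ext; [|apply (H O)]. intros n. now rewrite sum_O.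
    + rewrite sum_O. apply Series_ext. intros n. now rewrite sum_O.
  - split.
    + eapply ex_series_ext; [|apply (ex_series_add _ _ IH1 (H (S K)))].
      intros n. now rewrite sum_Sn.
    + rewrite sum_Sn, <- IH2. unfold plus; simpl. rewrite <- Series_plus; auto.
      apply Series_ext. intros n. now rewrite sum_Sn.
Qed.

(** For finitely many basis vectors the sum of the squared norms of their images may be exchanged
    with the sum over rows [n]. In each row Bessel's inequality for [G n] then gives the bound
    [sqnorm (G n)], uniformly in the number of basis vectors. *)
Lemma hilbert_schmidt_kernel (G : nat -> nat -> C) :
  (forall n, l2 (G n)) -> ex_series (fun n => sqnorm (G n)) ->
  hilbert_schmidt (fun g n => inner g (G n)).
Proof.
  intros HG HS.
  assert (B : forall u n, l2 u ->
    0 <= Cmod (inner u (G n)) ^ 2 <= sqnorm u * sqnorm (G n)).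
  { intros u n Hu. split; [apply pow2_ge_0|]. now apply Cauchy_Schwarz. }
  assert (HL : forall u, l2 u -> l2 (fun n => inner u (G n))).
  { intros u Hu. apply ex_series_dominated with (fun n => sqnorm u * sqnorm (G n)).
    - intros n; auto.
    - now apply ex_series_cmult. }
  split; [split; [|split; [|split]]|].
  - exact HL.
  - intros u v Hu Hv n.
    replace (fun m => u m + v m)%C with (fun m => u m + 1 * v m)%C
      by (apply functional_extensionality; intros; ring).
    rewrite inner_linear_l; auto. ring.
  - intros c u Hu n.
    now apply inner_scal_l.
  - exists (sqrt (Series (fun n => sqnorm (G n)))). intros u Hu.
    unfold l2_norm. rewrite <- sqrt_mult.
    + apply sqrt_le_1_alt. rewrite Rmult_comm.
      fold (sqnorm u). rewrite <- Series_scal_l. apply Series_le.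
      * intros n. now apply B.
      * now apply ex_series_cmult.
    + apply Series_nonneg; auto. intros n. now apply sqnorm_ge_0.
    + now apply (sqnorm_ge_0 u).
  - intros e [He [Ho _]].
    apply ex_series_of_bounded with (Series (fun n => sqnorm (G n))).
    + intros; apply pow2_ge_0.
    + intros K. rewrite (sum_n_ext _ (fun k => sqnorm (fun n => inner (e k) (G n)))).
      2: { intros k. now rewrite l2_norm_sqr by auto. }
      destruct (Series_sum_n (fun k n => Cmod (inner (e k) (G n)) ^ 2) K) as [_ Hs].
      { intros k. apply (HL (e k)), He. }
      unfold sqnorm at 1. rewrite <- Hs. apply Series_le; auto.
      intros n.
      rewrite (sum_n_ext _ (fun k => Cmod (inner (G n) (e k)) ^ 2)).
      2: { intros k. now rewrite (inner_conj (G n) (e k)), Cmod_conj. }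
      split; [|now apply Bessel_inequality].
      induction K; [rewrite sum_O; apply pow2_ge_0|].
      rewrite sum_Sn. unfold plus; simpl.
      pose proof (pow2_ge_0 (Cmod (inner (G n) (e (S K))))). simpl in *.
      enough (0 <= sum_n (fun k : nat =>
        Cmod (inner (G n) (e k)) * (Cmod (inner (G n) (e k)) * 1)) K) by lra.
      apply IHK. apply (Series_sum_n (fun k n => Cmod (inner (e k) (G n)) ^ 2) K).
      intros k. apply (HL (e k)), He.
Qed.

(** * The operator [J_omega] *)

Section Spectrum.

Context (am : R) (a b : nat -> R) (N0 : nat).
Context (ham : 0 < am) (ha : forall n, 0 < a n).
Context (hsum : ex_series (fun n => / a n)).
Context (hk : ex_series (fun n => Rabs (kappa am a n - 1))).
Context (hvar : ex_series (fun n => Rabs (beta am a b (S n) - beta am a b n))).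
Context (hN0 : exists delta : R, 0 < delta /\
  forall n : nat, (N0 <= n)%nat -> Rabs (beta am a b n) <= 1 - delta).

Notation asym := (has_asymptotics am a b N0).
Notation J := (J_omega am a b N0).
Notation Pz := (P am a b).
Notation sp := (sigma_plus am a b N0).
Notation sm := (sigma_minus am a b N0).

Lemma dom_Jmax_asymptotics u : dom_Jmax a b u -> exists s, asym u s.
Proof.
  intros [Hu HJ].
  apply asymptotics_exist with 0 (fun n => Cmod (jacobi a b u (S n))); auto.
  - lra.
  - intros; apply Cmod_ge_0.
  - apply (ex_series_shift _ 1 HJ).
  - intros n. lra.
Qed.

(** Removes [epsilon] from the boundary condition, so that membership is checked on any known
    asymptotic pair. *)
Lemma dom_J_omega om u : dom (J om) u <->
  dom_Jmax a b u /\ exists s, asym u s /\ fst s = (om * snd s)%C.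
Proof.
  unfold J_omega, s_plus, s_minus; simpl. split.
  - intros [H E]. split; auto.
    destruct (dom_Jmax_asymptotics u H) as [s Hs]. exists s. split; auto.
    rewrite (s_coef_eq am a b N0 ha hN0 u s Hs) in E. exact E.
  - intros [H [s [Hs E]]]. split; auto.
    rewrite (s_coef_eq am a b N0 ha hN0 u s Hs). exact E.
Qed.

Lemma dom_J_omega_linear om u v c : dom (J om) u -> dom (J om) v ->
  dom (J om) (fun n => u n + c * v n)%C.
Proof.
  rewrite !dom_J_omega. intros [[Hu Ju] [s [Hs E]]] [[Hv Jv] [s' [Hs' E']]].
  split; [split|].
  - now apply l2_linear.
  - replace (jacobi a b (fun n => u n + c * v n)%C) with
      (fun n => jacobi a b u n + c * jacobi a b v n)%C.
    + now apply l2_linear.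
    + apply functional_extensionality. intros n. now rewrite jacobi_linear.
  - eexists. split.
    + apply (asymptotics_linear am a b N0 ha u v s s' c); auto.
    + cbn [fst snd]. rewrite E, E'. ring.
Qed.

Lemma dom_J_omega_zero om : dom (J om) (fun _ => RtoC 0).
Proof.
  apply dom_J_omega. split; [split|].
  - apply l2_zero.
  - replace (jacobi a b (fun _ => RtoC 0)) with (fun _ : nat => RtoC 0).
    + apply l2_zero.
    + apply functional_extensionality. intros [|n]; simpl; ring.
  - exists (RtoC 0, RtoC 0). split; [now apply asymptotics_zero|simpl; ring].
Qed.

Lemma jacobi_P_fun z : jacobi a b (Pz z) = (fun n => z * Pz z n)%C.
Proof. apply functional_extensionality. intros n. now apply jacobi_P. Qed.

Lemma P_asym z : asym (Pz z) (sp z, sm z).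
Proof. now apply P_asymptotics. Qed.

Lemma P_l2 z : l2 (Pz z).
Proof. apply (asymptotics_l2 am a b N0 ha hsum) with (sp z, sm z), P_asym. Qed.

Lemma dom_J_omega_P om z : dom (J om) (Pz z) <-> sp z = (om * sm z)%C.
Proof.
  rewrite dom_J_omega. split.
  - intros [_ [s [Hs E]]].
    pose proof (asymptotics_unique am a b N0 ha hN0 _ _ _ Hs (P_asym z)).
    subst s. exact E.
  - intros E. split; [split|].
    + apply P_l2.
    + rewrite jacobi_P_fun. apply l2_scal, P_l2.
    + exists (sp z, sm z). split; [apply P_asym|exact E].
Qed.

(** An eigenvector satisfies every row including row 0, so it is a nonzero multiple of [P]; the
    boundary condition for it is that for [P]. *)
Lemma eigenvalue_iff om z : eigenvalue (J om) z <-> sp z = (om * sm z)%C.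
Proof.
  split.
  - intros [u [[Hd Hu] [n Hn]]]. simpl in Hu.
    pose proof (eigenvector_eq_P am a b ha z u Hu) as E.
    assert (H0 : u O <> RtoC 0).
    { intros h. apply Hn. rewrite E, h. ring. }
    apply dom_J_omega in Hd. destruct Hd as [_ [s [Hs Es]]].
    replace u with (fun n => u O * Pz z n)%C in Hs
      by (symmetry; apply functional_extensionality; exact E).
    pose proof (asymptotics_unique am a b N0 ha hN0 _ _ _ Hs
      (asymptotics_scal am a b N0 ha _ _ (u O) (P_asym z))) as Eq.
    subst s. cbn [fst snd] in Es.
    replace (sp z) with (/ u O * (u O * sp z))%C by (field; exact H0).
    rewrite Es. field. exact H0.
  - intros E. exists (Pz z). split; [split|].
    + now apply dom_J_omega_P.
    + intros n. now apply jacobi_P.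
    + exists O. unfold P; simpl. intros h. apply RtoC_inj in h. lra.
Qed.

(** A left inverse would have to send the zero sequence both to the eigenvector and to zero. *)
Lemma eigenvalue_in_spectrum om z : eigenvalue (J om) z -> spectrum (J om) z.
Proof.
  intros [u [[Hd Hu] [n Hn]]] [T [[_ HT] _]]. simpl in Hu.
  apply Hn. rewrite <- HT by exact Hd.
  rewrite <- (HT _ (dom_J_omega_zero om) n). f_equal.
  apply functional_extensionality. intros m. unfold shifted; simpl.
  rewrite Hu. destruct m; simpl; ring.
Qed.

Lemma delta_l2 n : l2 (fun m => if Nat.eqb m n then RtoC 1 else RtoC 0).
Proof.
  (* The majorant equals 1 at [m = n] and is positive elsewhere. *)
  apply ex_series_dominated with (fun m => a n * / a m).
  - intros m. split; [apply pow2_ge_0|]. destruct (Nat.eqb_spec m n).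
    + subst. rewrite Cmod_1, Rinv_r; [lra|apply Rgt_not_eq, ha].
    + rewrite Cmod_0. pose proof (ha n). pose proof (Rinv_0_lt_compat _ (ha m)). nra.
  - apply ex_series_cmult, hsum.
Qed.

(** * Green kernel and resolvent *)

Definition green (z : C) (psi : nat -> C) (n m : nat) : C :=
  (/ wronskian a (Pz z) psi O *
   (if Nat.leb m n then psi n * Pz z m else Pz z n * psi m))%C.

Section Green.

Context (om z : C) (psi : nat -> C).
Context (psi_solves : solves a b z psi) (psi_asym : asym psi (om, RtoC 1)).
Context (regular : sp z <> (om * sm z)%C).

Let W := wronskian a (Pz z) psi O.
Let G := green z psi.

(** If the Wronskian vanished, then [psi] would equal [psi O] times [P], as P_0 = 1. Comparing
    asymptotic pairs, [(om, 1)] would be a multiple of [(sp z, sm z)], against [regular]. *)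
Lemma wronskian_P_neq_0 : W <> RtoC 0.
Proof.
  intros h. unfold W, wronskian in h.
  replace (Pz z O) with (RtoC 1) in h by reflexivity.
  assert (E1 : psi 1%nat = (psi O * Pz z 1%nat)%C).
  { replace (psi 1%nat) with (/ RtoC (a O) * (RtoC (a O) *
      (RtoC 1 * psi 1%nat - Pz z 1%nat * psi O)) + psi O * Pz z 1%nat)%C
      by (field; now apply RtoC_a_neq_0).
    rewrite h. ring. }
  assert (E : forall n, psi n = (psi O * Pz z n)%C).
  { apply (solves_ext a b ha z); auto.
    - apply solves_scal. now apply P_solves.
    - unfold P; simpl. ring. }
  pose proof (asymptotics_scal am a b N0 ha _ _ (psi O) (P_asym z)) as H.
  replace (fun n => psi O * Pz z n)%C with psi in H
    by (apply functional_extensionality; exact E).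
  pose proof (asymptotics_unique am a b N0 ha hN0 _ _ _ psi_asym H) as Eq.
  pose proof (f_equal fst Eq) as Eq1. pose proof (f_equal snd Eq) as Eq2.
  cbn [fst snd] in Eq1, Eq2.
  apply regular.
  transitivity (sp z * (psi O * sm z))%C; [rewrite <- Eq2; ring|].
  rewrite Eq1. ring.
Qed.

Lemma green_bound : exists M, 0 <= M /\ forall n m,
  Cmod (/ W * (psi n * Pz z m)) ^ 2 <= M * / a n * / a m.
Proof.
  destruct (asymptotics_sq_bound am a b N0 ha _ _ (P_asym z)) as [K [K0 HK]].
  destruct (asymptotics_sq_bound am a b N0 ha _ _ psi_asym) as [L [L0 HL]].
  exists (Cmod (/ W) ^ 2 * (L * K)). split.
  { apply Rmult_le_pos; [apply pow2_ge_0|now apply Rmult_le_pos]. }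
  intros n m. rewrite !Cmod_mult, !Rpow_mult_distr.
  rewrite !Rmult_assoc. apply Rmult_le_compat_l; [apply pow2_ge_0|].
  replace (L * (K * (/ a n * / a m))) with ((L * / a n) * (K * / a m)) by ring.
  apply Rmult_le_compat; auto; apply pow2_ge_0.
Qed.

Lemma green_sq_bound : exists M, 0 <= M /\ forall n m,
  Cmod (G n m) ^ 2 <= M * / a n * / a m.
Proof.
  destruct green_bound as [M [M0 HM]]. exists M. split; auto. intros n m.
  unfold G, green. fold W. destruct (Nat.leb m n).
  - apply HM.
  - rewrite (Cmult_comm (Pz z n)). eapply Rle_trans; [apply HM|]. lra.
Qed.

Lemma green_l2 n : l2 (G n).
Proof.
  destruct green_sq_bound as [M [M0 HM]].
  apply ex_series_dominated with (fun m => M * / a n * / a m).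
  - intros m. split; [apply pow2_ge_0|apply HM].
  - apply ex_series_cmult, hsum.
Qed.

Lemma green_sqnorm_summable : ex_series (fun n => sqnorm (G n)).
Proof.
  destruct green_sq_bound as [M [M0 HM]].
  apply ex_series_dominated with (fun n => M * Series (fun m => / a m) * / a n).
  - intros n. split; [apply sqnorm_ge_0, green_l2|].
    replace (M * Series (fun m => / a m) * / a n) with
      (M * / a n * Series (fun m => / a m)) by ring.
    rewrite <- Series_scal_l. apply Series_le.
    + intros m. split; [apply pow2_ge_0|apply HM].
    + apply ex_series_cmult, hsum.
  - apply ex_series_cmult, hsum.
Qed.

(** For fixed [m] the kernel is a multiple of [P] up to index [m] and of [psi] from [m] on, both
    formulas agreeing at [m]. Above the diagonal row 0 may occur, and [P] satisfies it; below the
    diagonal [n] is at least 1, where [psi] satisfies its rows. *)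
Lemma jacobi_green n m : jacobi a b (fun k => G k m) n =
  ((if Nat.eqb m n then RtoC 1 else RtoC 0) + z * G n m)%C.
Proof.
  pose proof wronskian_P_neq_0 as HW.
  destruct (lt_eq_lt_dec n m) as [[h|h]|h].
  - replace (m =? n)%nat with false by (symmetry; apply Nat.eqb_neq; lia).
    assert (E : forall k, (k <= m)%nat -> G k m = (/ W * (Pz z k * psi m))%C).
    { intros k Hk. unfold G, green. fold W.
      destruct (Nat.leb_spec m k); auto. replace k with m by lia. ring. }
    rewrite (E n) by lia.
    transitivity (/ W * psi m * jacobi a b (Pz z) n)%C.
    + destruct n; simpl; rewrite !E by lia; ring.
    + rewrite jacobi_P by auto. ring.
  - subst m. rewrite Nat.eqb_refl.
    assert (EW : W = (RtoC (a n) * (Pz z n * psi (S n) - Pz z (S n) * psi n))%C).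
    { symmetry. apply (wronskian_const a b ha z); auto. now apply P_solves. }
    pose proof (jacobi_P am a b ha z n) as HP.
    assert (E1 : G n n = (/ W * (psi n * Pz z n))%C).
    { unfold G, green. now rewrite Nat.leb_refl. }
    assert (E2 : G (S n) n = (/ W * (psi (S n) * Pz z n))%C).
    { unfold G, green. replace (n <=? S n)%nat with true; auto.
      symmetry. apply Nat.leb_le. lia. }
    (* At the diagonal, the row differs from [/ W * psi n] times the row of [P] only in its last
       term, and this difference is the Wronskian at [n] divided by [W]. *)
    transitivity (/ W * (W + z * (psi n * Pz z n)))%C.
    + replace (z * (psi n * Pz z n))%C with ((z * Pz z n) * psi n)%C by ring.
      rewrite <- HP. rewrite EW at 2.
      destruct n as [|n].
      * simpl. rewrite E1, E2. ring.
      * assert (E3 : G n (S n) = (/ W * (Pz z n * psi (S n)))%C).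
        { unfold G, green. replace (S n <=? n)%nat with false; auto.
          symmetry. apply Nat.leb_gt. lia. }
        simpl. rewrite E1, E2, E3. ring.
    + rewrite E1. field. exact HW.
  - replace (m =? n)%nat with false by (symmetry; apply Nat.eqb_neq; lia).
    assert (E : forall k, (m <= k)%nat -> G k m = (/ W * (psi k * Pz z m))%C).
    { intros k Hk. unfold G, green. fold W. apply Nat.leb_le in Hk. now rewrite Hk. }
    destruct n as [|n]; [lia|].
    transitivity (/ W * Pz z m * jacobi a b psi (S n))%C.
    + simpl. rewrite !E by lia. ring.
    + rewrite psi_solves, E by lia. ring.
Qed.

Definition green_op (g : nat -> C) (n : nat) : C := bilinear g (G n).

Lemma jacobi_green_op g n : l2 g ->
  jacobi a b (green_op g) n = (z * green_op g n + g n)%C.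
Proof.
  intros Hg. pose proof green_l2 as HG.
  transitivity (bilinear g (fun m => jacobi a b (fun k => G k m) n)).
  - assert (HC : forall c k, l2 (fun m => c * G k m)%C)
      by (intros; now apply l2_scal).
    unfold green_op. destruct n as [|n]; simpl.
    + rewrite bilinear_linear_r, bilinear_scal_r; trivial.
    + rewrite !bilinear_linear_r, bilinear_scal_r; trivial. now apply l2_linear.
  - replace (fun m => jacobi a b (fun k => G k m) n) with
      (fun m => (if Nat.eqb m n then RtoC 1 else RtoC 0) + z * G n m)%C
      by (apply functional_extensionality; intros; now rewrite jacobi_green).
    rewrite bilinear_linear_r, bilinear_delta; auto.
    + unfold green_op. ring.
    + apply delta_l2.
Qed.

(** Subtracting the rank-one kernel [/ W * psi n * Pz z m] leaves [K n m], which vanishes for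
    [m <= n]. Its squared norm in row [n] is therefore O(1/a_n) times a tail of the sum of 1/a_m, so
    its contribution is o(a_n^(-1/2)). What remains is [c * psi n], which obeys the boundary
    condition of [psi]. *)
Lemma green_op_asymptotics g : l2 g -> exists c, asym (green_op g) (c * om, c)%C.
Proof.
  intros Hg. set (c := (/ W * bilinear g (Pz z))%C). exists c.
  set (K := fun n m => (G n m + (- (/ W) * psi n) * Pz z m)%C).
  assert (HK : forall n, l2 (K n)).
  { intros n. apply l2_linear; [apply green_l2|apply P_l2]. }
  assert (E : green_op g = (fun n => bilinear g (K n) + c * psi n)%C).
  { apply functional_extensionality. intros n. unfold K.
    rewrite bilinear_linear_r; [|auto|apply green_l2|apply P_l2].
    unfold green_op, c. ring. }
  destruct green_bound as [M [M0 HM]].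
  (* The constant 4 comes from (p + q)^2 <= 2 p^2 + 2 q^2, each square being at most M / (a_n
     a_m). *)
  assert (B : forall n, sqnorm (K n) <=
    4 * M * / a n * Series (fun k => / a (S n + k)%nat)).
  { intros n. unfold sqnorm. rewrite (Series_incr_n _ (S n)); [|lia|apply HK].
    rewrite sum_eq_R0.
    2: { intros m Hm. simpl in Hm. unfold K, G, green. fold W.
         apply Nat.leb_le in Hm. rewrite Hm.
         replace (_ + _)%C with (RtoC 0) by ring. rewrite Cmod_0. ring. }
    rewrite Rplus_0_l, <- Series_scal_l. apply Series_le.
    - intros k. split; [apply pow2_ge_0|].
      set (m := (S n + k)%nat).
      replace (K n m) with (/ W * (psi m * Pz z n) - / W * (psi n * Pz z m))%C.
      + eapply Rle_trans.
        * apply pow_incr. split; [apply Cmod_ge_0|apply Cmod_triangle_minus].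
        * pose proof (HM n m). pose proof (HM m n).
          set (p := Cmod (/ W * (psi m * Pz z n))) in *.
          set (q := Cmod (/ W * (psi n * Pz z m))) in *.
          pose proof (pow2_ge_0 (p - q)). lra.
      + unfold K, G, green. fold W. replace (m <=? n)%nat with false; [ring|].
        symmetry. apply Nat.leb_gt. unfold m. lia.
    - apply ex_series_cmult. apply (ex_series_shift _ (S n) hsum). }
  assert (D0 : asym (fun n => bilinear g (K n)) (RtoC 0, RtoC 0)).
  { apply asymptotics_alt; auto. cbn [fst snd].
    apply o1_of_sqr with
      (fun n => sqnorm g * (4 * M) * Series (fun k => / a (S n + k)%nat)).
    - intros n. replace (RtoC (sqrt (a n)) * bilinear g (K n) - _)%C with
        (RtoC (sqrt (a n)) * bilinear g (K n))%C by ring.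
      rewrite Cmod_mult, Cmod_R, Rabs_pos_eq by apply sqrt_pos.
      rewrite Rpow_mult_distr.
      replace (sqrt (a n) ^ 2) with (a n) by (rewrite <- (Rsqrt_sqr a ha n) at 1; ring).
      apply Rle_trans with (a n * (sqnorm g * sqnorm (K n))).
      + apply Rmult_le_compat_l; [apply Rlt_le, ha|].
        eapply Rle_trans; [apply Cauchy_Schwarz; auto; now apply l2_conj|].
        apply Req_le. f_equal. apply Series_ext. intros m. now rewrite Cmod_conj.
      + replace (sqnorm g * (4 * M) * Series (fun k => / a (S n + k)%nat)) with
          (a n * (sqnorm g * (4 * M * / a n * Series (fun k => / a (S n + k)%nat))))
          by (field; apply Rgt_not_eq, ha).
        apply Rmult_le_compat_l; [apply Rlt_le, ha|].
        apply Rmult_le_compat_l; [now apply sqnorm_ge_0|apply B].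
    - replace (Finite 0) with (Finite (sqnorm g * (4 * M) * 0)) by (f_equal; ring).
      apply (is_lim_seq_scal_l _ _ (Finite 0)). exact (Series_tail_lim _ hsum). }
  rewrite E.
  replace (c * om, c)%C with ((0 + c * om)%C, (0 + c * 1)%C) by (f_equal; ring).
  apply (asymptotics_linear am a b N0 ha _ psi (RtoC 0, RtoC 0) (om, RtoC 1) c D0 psi_asym).
Qed.

Lemma green_op_hilbert_schmidt : hilbert_schmidt green_op.
Proof.
  apply (hilbert_schmidt_kernel (fun n m => Cconj (G n m))).
  - intros n. apply l2_conj, green_l2.
  - eapply ex_series_ext; [|apply green_sqnorm_summable].
    intros n. apply Series_ext. intros m. now rewrite Cmod_conj.
Qed.

Lemma green_op_resolvent : is_resolvent (J om) z green_op.
Proof.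
  destruct green_op_hilbert_schmidt as [[HT _] _].
  assert (R1 : forall g, l2 g -> dom (J om) (green_op g) /\
    forall n, shifted (J om) z (green_op g) n = g n).
  { intros g Hg. split.
    - apply dom_J_omega. split; [split|].
      + auto.
      + replace (jacobi a b (green_op g)) with (fun n => g n + z * green_op g n)%C.
        * apply l2_linear; auto.
        * apply functional_extensionality. intros n.
          rewrite jacobi_green_op by auto. ring.
      + destruct (green_op_asymptotics g Hg) as [c Hc].
        exists (c * om, c)%C. split; auto. cbn [fst snd]. ring.
    - intros n. unfold shifted; simpl. rewrite jacobi_green_op by auto. ring. }
  split; auto.
  intros u Hu n.
  assert (Hs : l2 (shifted (J om) z u)).
  { pose proof (proj1 (dom_J_omega om u) Hu) as [[H1 H2] _].
    replace (shifted (J om) z u) with (fun n => jacobi a b u n + (- z) * u n)%C.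
    - now apply l2_linear.
    - apply functional_extensionality. intros m. unfold shifted; simpl. ring. }
  destruct (R1 _ Hs) as [Hd Hr].
  (* The difference of the two sides lies in the domain and is annihilated by the operator minus
     [z]; if it were nonzero, [z] would be an eigenvalue, against [regular]. *)
  destruct (classic ((green_op (shifted (J om) z u) n + - (1) * u n)%C = RtoC 0))
    as [h|h].
  - transitivity (green_op (shifted (J om) z u) n + - (1) * u n + u n)%C; [ring|].
    rewrite h. ring.
  - exfalso. apply regular, eigenvalue_iff.
    exists (fun n => green_op (shifted (J om) z u) n + - (1) * u n)%C.
    split; [split|exists n; exact h].
    + now apply dom_J_omega_linear.
    + intros m. specialize (Hr m). unfold shifted in Hr at 1. simpl in Hr.
      unfold J_omega at 1. cbn [act]. rewrite jacobi_linear.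
      replace (jacobi a b (green_op (shifted (J om) z u)) m) with
        (z * green_op (shifted (J om) z u) m + shifted (J om) z u m)%C
        by (rewrite <- Hr; ring).
      unfold shifted at 2. simpl. ring.
Qed.

End Green.

(** * The spectrum: location, orthogonality of eigenvectors, isolation *)

Lemma resolvent_exists om z : sp z <> (om * sm z)%C ->
  exists T, is_resolvent (J om) z T /\ hilbert_schmidt T.
Proof.
  intros H.
  destruct (solves_with_asymptotics am a b N0 ham ha hsum hk hvar hN0 z (om, RtoC 1))
    as [psi [Hs Ha]].
  exists (green_op z psi). split.
  - now apply green_op_resolvent.
  - now apply green_op_hilbert_schmidt with om.
Qed.

Lemma spectrum_iff om z : spectrum (J om) z <-> sp z = (om * sm z)%C.
Proof.
  split.
  - intros H. destruct (classic (sp z = (om * sm z)%C)) as [|h]; auto.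
    exfalso. apply H. destruct (resolvent_exists om z h) as [T [H1 [H2 _]]].
    now exists T.
  - intros H. now apply eigenvalue_in_spectrum, eigenvalue_iff.
Qed.

(** By discrete integration by parts, the partial sums of the difference are minus the Wronskian of
    [u] and the conjugate of [v]. Conjugation swaps the entries of an asymptotic pair, so with |om|
    = 1 the two boundary conditions give exactly the relation under which [wronskian_o1] yields the
    limit 0. *)
Lemma J_omega_symmetric om u v : Cmod om = 1 ->
  dom (J om) u -> dom (J om) v ->
  inner (jacobi a b u) v = inner u (jacobi a b v).
Proof.
  intros Hom Hu Hv. apply dom_J_omega in Hu. apply dom_J_omega in Hv.
  destruct Hu as [[Hu Ju] [s [Hs E]]]. destruct Hv as [[Hv Jv] [s' [Hs' E']]].
  assert (Hw : o1 (wronskian a u (fun n => Cconj (v n)))).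
  { apply (wronskian_o1 am a b N0 ha hsum hk _ _ s (Cconj (snd s'), Cconj (fst s'))); auto.
    - now apply asymptotics_conj.
    - cbn [fst snd]. rewrite E, E', Cmult_conj.
      replace (om * snd s * (Cconj om * Cconj (snd s')))%C with
        ((om * Cconj om) * (snd s * Cconj (snd s')))%C by ring.
      rewrite <- Cmod2_conj, Hom. simpl. rewrite !Rmult_1_r. ring. }
  assert (H1 := l2_mult _ _ Ju Hv). assert (H2 := l2_mult _ _ Hu Jv).
  assert (D : csum (fun n => jacobi a b u n * Cconj (v n)
                     + - (1) * (u n * Cconj (jacobi a b v n)))%C = RtoC 0).
  { apply (csum_of_partial_sums _ (fun n => - wronskian a u (fun n => Cconj (v n)) n)%C).
    - unfold wronskian, jacobi.
      rewrite !Cplus_conj, !Cmult_conj, !Cconj_RtoC. ring.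
    - intros n. unfold wronskian, jacobi.
      rewrite !Cplus_conj, !Cmult_conj, !Cconj_RtoC. ring.
    - eapply o1_ext; [|apply (o1_opp _ Hw)]. intros n. cbv beta. ring. }
  rewrite csum_plus, csum_scal in D; auto.
  - change (csum (fun n => jacobi a b u n * Cconj (v n))%C) with (inner (jacobi a b u) v) in D.
    change (csum (fun n => u n * Cconj (jacobi a b v n))%C) with (inner u (jacobi a b v)) in D.
    transitivity (inner (jacobi a b u) v + - (1) * inner u (jacobi a b v)
                  + inner u (jacobi a b v))%C; [ring|].
    rewrite D. ring.
  - eapply ex_series_ext; [|exact H2]. intros n. cbv beta.
    rewrite (Cmod_mult (- (1))), Cmod_m1. apply eq_sym, Rmult_1_l.
Qed.

Lemma sqnorm_P_ge_1 z : 1 <= sqnorm (Pz z).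
Proof.
  replace 1 with (Cmod (Pz z O) ^ 2).
  - apply (term_le_Series (fun n => Cmod (Pz z n) ^ 2)).
    + intros; apply pow2_ge_0.
    + apply P_l2.
  - unfold P; simpl. rewrite Cmod_1. ring.
Qed.

Lemma inner_P om w z : Cmod om = 1 -> sp w = (om * sm w)%C -> sp z = (om * sm z)%C ->
  ((w - Cconj z) * inner (Pz w) (Pz z))%C = RtoC 0.
Proof.
  intros Hom Hw Hz.
  pose proof (J_omega_symmetric om (Pz w) (Pz z) Hom) as H.
  rewrite !dom_J_omega_P in H. specialize (H Hw Hz).
  rewrite !jacobi_P_fun, inner_scal_l in H; try apply P_l2.
  rewrite (inner_conj (fun n => z * Pz z n)%C), inner_scal_l, Cmult_conj,
    <- inner_conj in H; try apply P_l2.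
  transitivity (w * inner (Pz w) (Pz z) - Cconj z * inner (Pz w) (Pz z))%C; [ring|].
  rewrite H. ring.
Qed.

Lemma P_orthogonal om w z : Cmod om = 1 -> w <> z ->
  sp w = (om * sm w)%C -> sp z = (om * sm z)%C -> inner (Pz w) (Pz z) = RtoC 0.
Proof.
  intros Hom Hne Hw Hz.
  assert (Hreal : Cconj z = z).
  { pose proof (inner_P om z z Hom Hz Hz) as H. rewrite inner_self in H.
    pose proof (sqnorm_P_ge_1 z) as H1.
    rewrite Cmult_comm in H. apply Cmult_eq_0_l in H.
    - transitivity (z - (z - Cconj z))%C; [ring|]. rewrite H. ring.
    - intros h. apply RtoC_inj in h. lra. }
  pose proof (inner_P om w z Hom Hw Hz) as H. rewrite Hreal in H.
  apply Cmult_eq_0_l in H; auto.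
  intros h. apply Hne. transitivity (w - z + z)%C; [ring|]. rewrite h. ring.
Qed.

Lemma spectrum_isolated om z : Cmod om = 1 -> spectrum (J om) z ->
  isolated_in (spectrum (J om)) z.
Proof.
  intros Hom Hz. apply spectrum_iff in Hz.
  assert (Hom0 : om <> RtoC 0) by (apply Cmod_gt_0; lra).
  destruct (resolvent_exists (- om) z) as [T [[HT _] [[HT1 [_ [_ [K HK]]]] _]]].
  (* Were [z] an eigenvalue for both [om] and [- om], both coefficients of [P] would vanish, hence
     [P] itself, although P_0 = 1. *)
  { intros h. rewrite Hz in h.
    assert (h2 : sm z = RtoC 0).
    { transitivity (/ (2 * om) * (om * sm z - - om * sm z))%C.
      - field. exact Hom0.
      - rewrite h. ring. }
    pose proof (P_asym z) as Ha. rewrite Hz, h2, Cmult_0_r in Ha.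
    pose proof (solves_asymptotics_zero am a b N0 ham ha hsum hk hvar hN0 z _
      (P_solves am a b ha z) Ha O) as h3.
    unfold P in h3; simpl in h3. apply RtoC_inj in h3. lra. }
  (* [K] is merely some operator bound, with no sign given; [Rabs K + 1] is a positive bound. *)
  exists (/ (Rabs K + 1)).
  assert (K1 : 0 < Rabs K + 1) by (pose proof (Rabs_pos K); lra).
  split; [now apply Rinv_0_lt_compat|].
  intros w Hw Hne. apply spectrum_iff in Hw.
  pose proof (P_l2 w) as Hl. destruct (HT _ Hl) as [_ HTe].
  set (t := T (Pz w)) in *.
  assert (Ht : l2 t) by now apply HT1.
  (* [t] is known to satisfy the boundary condition for [- om], so the combination need not lie in
     the domain for [om]. [eigenvector_eq_P] asks only for the rows of the recurrence, which
     hold. *)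
  assert (Ey : forall n, (Pz w n + - (w - z) * t n)%C =
     ((Pz w O + - (w - z) * t O) * Pz z n)%C).
  { apply (eigenvector_eq_P am a b ha z (fun n => Pz w n + - (w - z) * t n)%C).
    intros n. rewrite jacobi_linear, jacobi_P by auto.
    specialize (HTe n). unfold shifted in HTe; simpl in HTe.
    replace (jacobi a b t n) with (z * t n + Pz w n)%C by (rewrite <- HTe; ring).
    ring. }
  assert (Eo : inner (Pz w) (fun n => Pz w n + - (w - z) * t n)%C = RtoC 0).
  { replace (fun n => Pz w n + - (w - z) * t n)%C with
      (fun n => (Pz w O + - (w - z) * t O) * Pz z n)%C
      by (symmetry; apply functional_extensionality; exact Ey).
    rewrite inner_conj, inner_scal_l; [|apply P_l2|auto].
    rewrite (inner_conj (Pz w) (Pz z)), (P_orthogonal om w z), Cmult_conj, Cconj_conj by auto.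
    ring. }
  rewrite inner_linear_r, inner_self in Eo by auto.
  assert (B : sqnorm (Pz w) <= Cmod (w - z) * (l2_norm (Pz w) * l2_norm t)).
  { replace (sqnorm (Pz w)) with (Cmod (RtoC (sqnorm (Pz w)))).
    - replace (RtoC (sqnorm (Pz w))) with (Cconj (w - z) * inner (Pz w) t)%C.
      + rewrite Cmod_mult, Cmod_conj. apply Rmult_le_compat_l; [apply Cmod_ge_0|].
        now apply inner_le_l2_norm.
      + rewrite Copp_conj in Eo.
        transitivity (Cconj (w - z) * inner (Pz w) t +
          (RtoC (sqnorm (Pz w)) + - Cconj (w - z) * inner (Pz w) t))%C; [|ring].
        rewrite Eo. ring.
    - rewrite Cmod_R, Rabs_pos_eq; auto. now apply sqnorm_ge_0. }
  pose proof (sqnorm_P_ge_1 w) as H1.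
  specialize (HK _ Hl). fold t in HK.
  pose proof (l2_norm_sqr _ Hl) as Hsq.
  assert (N0' : 0 <= l2_norm (Pz w)) by apply sqrt_pos.
  pose proof (Cmod_ge_0 (w - z)) as C0. pose proof (Rle_abs K) as KA.
  set (x := l2_norm (Pz w)) in *. set (d := Cmod (w - z)) in *.
  assert (B2 : sqnorm (Pz w) <= d * (Rabs K + 1) * sqnorm (Pz w)).
  { eapply Rle_trans; [exact B|]. rewrite Rmult_assoc.
    apply Rmult_le_compat_l; auto. rewrite <- Hsq.
    apply Rle_trans with (x * (K * x)).
    - now apply Rmult_le_compat_l.
    - pose proof (pow2_ge_0 x). nra. }
  apply Rmult_le_reg_r with (Rabs K + 1); auto.
  rewrite Rinv_l by lra.
  apply Rmult_le_reg_r with (sqnorm (Pz w)); lra.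
Qed.

Lemma J_omega_discrete_spectrum om : Cmod om = 1 -> discrete_spectrum (J om).
Proof.
  intros Hom z Hz. split; [|split].
  - now apply spectrum_isolated.
  - now apply eigenvalue_iff, spectrum_iff.
  (* [sum_n] up to index [O] has one term, so this bounds the dimension of the eigenspace by 1. *)
  - exists O, (fun _ => Pz z). intros u [_ Hu]. exists (fun _ => u O). intros n.
    rewrite sum_O. now apply (eigenvector_eq_P am a b ha z u Hu).
Qed.

End Spectrum.

Theorem corollary7p17 (am : R) (a b : nat -> R) (beta_inf : R) (N0 : nat)
  (omega : C)
  (ham : 0 < am) (ha : forall n, 0 < a n)
  (hsum : ex_series (fun n => / a n))
  (ha_lim : is_lim_seq a p_infty)
  (hbeta_lim : is_lim_seq (beta am a b) beta_inf)
  (hbeta_inf : Rabs beta_inf < 1)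
  (hk : ex_series (fun n => Rabs (kappa am a n - 1)))
  (hbeta_var : ex_series (fun n => Rabs (beta am a b (S n) - beta am a b n)))
  (hN0 : exists delta : R, 0 < delta /\
     forall n : nat, (N0 <= n)%nat -> Rabs (beta am a b n) <= 1 - delta)
  (homega : Cmod omega = 1) :
  let J := J_omega am a b N0 omega in
  (forall z : C, ~ eigenvalue J z ->
     exists T, is_resolvent J z T /\ hilbert_schmidt T) /\
  discrete_spectrum J /\
  (forall z : C, spectrum J z <->
     (sigma_plus am a b N0 z - omega * sigma_minus am a b N0 z)%C = RtoC 0).
Proof.
  intros J. split; [|split].
  - intros z Hz. apply resolvent_exists; auto.
    intros h. apply Hz. now apply eigenvalue_iff.
  - now apply J_omega_discrete_spectrum.
  - intros z. unfold J. rewrite spectrum_iff by auto. split; intros H.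
    + rewrite H. ring.
    + transitivity (sigma_plus am a b N0 z - omega * sigma_minus am a b N0 z
                    + omega * sigma_minus am a b N0 z)%C; [ring|].
      rewrite H. ring.
Qed.
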